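(* For every fixed $k\ge 3$, the $k$-OPT Optimization problem on an $n$-vertex graph can be solved in $\mathcal{O}(n^{\lfloor 2k/3\rfloor+1})$ time.
   Context: A tour of a graph is a Hamiltonian cycle; its weight is the sum of its edge weights. A $k$-move of a tour $T$ replaces a set of $k$ edges of $T$ by another set of $k$ edges of the graph so that the result is again a tour (degenerate moves may delete and reinsert the same edge). $k$-OPT Optimization: given a complete undirected graph $G$ on $n$ vertices with a symmetric distance function $d$ on its edges and a tour $T$, compute a $k$-move that gives the largest decrease of the weight of $T$, or report that no improving $k$-move exists. *)

(* Defs.v *)
From Stdlib Require Import ZArith.
From mathcomp Require Import all_boot.

Set Implicit Arguments.
Unset Strict Implicit.
Unset Printing Implicit Defensive.

(* Vertices of K_n are 0, ..., n-1.  An undirected edge {u,v} is       *)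
(* represented canonically by the ordered pair (min u v, max u v).      *)

Definition edge (u v : nat) : nat * nat := (minn u v, maxn u v).

Definition is_edge (n : nat) (e : nat * nat) : bool := (e.1 < e.2) && (e.2 < n).

(* A tour (Hamiltonian cycle of K_n), given by the cyclic order of its vertices. *)
Definition is_tour (n : nat) (s : seq nat) : Prop :=
  3 <= n /\ perm_eq s (iota 0 n).

(* Edge set of the tour s (a list of n distinct edges when is_tour n s). *)
Definition tour_edges (n : nat) (s : seq nat) : seq (nat * nat) :=
  [seq edge (nth 0 s i) (nth 0 s ((i + 1) %% n)) | i <- iota 0 n].

(* A k-move of tour T: X is a set of k edges of T, Y a set of k edges of K_n,
   and (E(T) \ X) + Y is exactly the edge set of some tour.  X and Y may
   intersect (degenerate moves). *)
Definition is_kmove (k n : nat) (T : seq nat) (X Y : seq (nat * nat)) : Prop :=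
  [/\ [/\ uniq X, size X = k & {subset X <= tour_edges n T}],
      [/\ uniq Y, size Y = k & all (is_edge n) Y] &
      (exists T', is_tour n T' /\
        perm_eq (tour_edges n T') ([seq e <- tour_edges n T | e \notin X] ++ Y))].

Definition wsum (d : nat -> nat -> Z) (E : seq (nat * nat)) : Z :=
  foldr (fun e acc => (d e.1 e.2 + acc)%Z) 0%Z E.

Definition delta (d : nat -> nat -> Z) (X Y : seq (nat * nat)) : Z :=
  (wsum d Y - wsum d X)%Z.

(* Part 2: the machine model (unit-cost RAM with integer memory).      *)

Inductive instr : Type :=
| IConst of Z & Z        (* IConst a c   : M[a] := c                 *)
| IAdd of Z & Z & Z      (* IAdd a b c   : M[a] := M[b] + M[c]       *)
| ISub of Z & Z & Z      (* ISub a b c   : M[a] := M[b] - M[c]       *)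
| ILoad of Z & Z         (* ILoad a b    : M[a] := M[M[b]]           *)
| IStore of Z & Z        (* IStore a b   : M[M[a]] := M[b]           *)
| IJlt of Z & Z & nat.   (* IJlt a b l   : if M[a] < M[b] goto l     *)

Definition program := seq instr.
Definition memory := Z -> Z.

Definition upd (m : memory) (a v : Z) : memory :=
  fun x => if Z.eqb x a then v else m x.

Definition step (P : program) (c : nat * memory) : option (nat * memory) :=
  let: (pc, m) := c in
  match (if pc < size P then Some (nth (IJlt 0%Z 0%Z 0) P pc) else None) with
  | None => None
  | Some i => Some
    match i with
    | IConst a v => (pc.+1, upd m a v)
    | IAdd a b c => (pc.+1, upd m a (m b + m c)%Z)
    | ISub a b c => (pc.+1, upd m a (m b - m c)%Z)
    | ILoad a b => (pc.+1, upd m a (m (m b)))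
    | IStore a b => (pc.+1, upd m (m a) (m b))
    | IJlt a b l => if Z.ltb (m a) (m b) then (l, m) else (pc.+1, m)
    end
  end.

Fixpoint run (P : program) (t : nat) (c : nat * memory) : option memory :=
  match step P c with
  | None => Some c.2
  | Some c' => match t with 0 => None | t'.+1 => run P t' c' end
  end.

(* Input encoding: M[0] = n; M[1..n] = the tour T (vertex sequence);
   M[n+1 + i*n + j] = d(i,j) for i, j < n; all other cells are 0. *)
Definition init_mem (n : nat) (T : seq nat) (d : nat -> nat -> Z) : memory :=
  fun a =>
    if Z.eqb a 0 then Z.of_nat n
    else if (1 <=? a)%Z && (a <=? Z.of_nat n)%Z then Z.of_nat (nth 0 T (Z.to_nat a).-1)
    else if (Z.of_nat n + 1 <=? a)%Z && (a <? Z.of_nat n + 1 + Z.of_nat (n * n))%Z then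
      let off := (Z.to_nat a - n.+1)%N in d (off %/ n) (off %% n)
    else 0%Z.

(* Output encoding: M[0] = 0 means "no improving k-move";
   M[0] = 1 means a move is returned: for t < k, the t-th removed edge is
   {M[1+2t], M[2+2t]} and the t-th added edge is {M[1+2k+2t], M[2+2k+2t]}. *)
Definition out_edge (m : memory) (a : nat) : nat * nat :=
  edge (Z.to_nat (m (Z.of_nat a))) (Z.to_nat (m (Z.of_nat a.+1))).

Definition out_removed (k : nat) (m : memory) : seq (nat * nat) :=
  [seq out_edge m (1 + 2 * t) | t <- iota 0 k].

Definition out_added (k : nat) (m : memory) : seq (nat * nat) :=
  [seq out_edge m (1 + 2 * k + 2 * t) | t <- iota 0 k].

Definition kopt_correct (k n : nat) (T : seq nat) (d : nat -> nat -> Z) (m : memory) : Prop :=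
  (m 0%Z = 0%Z /\ forall X Y, is_kmove k n T X Y -> (0 <= delta d X Y)%Z)
  \/
  (m 0%Z = 1%Z /\
   let X := out_removed k m in let Y := out_added k m in
   [/\ is_kmove k n T X Y, (delta d X Y < 0)%Z &
       forall X' Y', is_kmove k n T X' Y' -> (delta d X Y <= delta d X' Y')%Z]).

(* Main.v *)
From HB Require Import structures.
Require Import Defs.
From Stdlib Require Import ZArith Lia.
From mathcomp Require Import all_boot.
From mathcomp Require Import zify.

(* A k-move cuts the tour at positions p_0 < ... < p_{k-1} and glues the k
   segments together in another cyclic order, some of them reversed; there are
   only O(1) such patterns.  For a fixed pattern the cost is a sum of terms, each
   depending on at most two of the p_j, and every p_j shares a term with at most
   two others.  A greedily chosen set U of at least k/3 indices thus contains no
   two indices sharing a term.  Enumerate the values of the at most 2k/3 other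
   positions; the cost is then a sum of functions of the single p_j, and the only
   constraint left is p_0 < ... < p_{k-1}.  One sweep of q over the n positions,
   maintaining for every j the best choice of p_0 < ... < p_{j-1} < q, solves
   this in O(n) time. *)

Set Implicit Arguments.
Unset Strict Implicit.
Unset Printing Implicit Defensive.

(** * Structured commands on registers and their compilation *)

(** The degree bound two has a simple source: a removed edge has two endpoints, and each of them is
    the end of exactly one added edge. Patterns, their symbolic added edges and the sets U depend on
    [k] alone, so all of them are unrolled in the program text; at run time only positions vary. The
    exponent is therefore a nesting depth of loops: [k - |U|] enumerating loops and one sweep.

    The order constraint ties enumerated and free positions together, so the free ones cannot be
    minimised one at a time. For this reason the sweep has a level for every index, the enumerated
    ones included, and each level stores the chosen positions besides their cost.

    Optimality rests on the converse of gluing: any tour that keeps all edges of the segments must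
    traverse each segment contiguously, forwards or backwards. This is shown by opening the new tour
    at an added edge and peeling segments off the resulting path. *)

Definition reg : Type := (nat * nat * nat)%type.

(** Input and output occupy nonnegative cells, so registers at negative addresses can never clash
    with them. The existence is sealed by an opaque proof, so that [addr] never computes. *)
Lemma register_addresses :
  {f : reg -> Z | injective f /\ forall r, (f r < 0)%Z}.
Proof.
exists (fun r => (- Z.of_nat (pickle r) - 1)%Z); split; last by move=> r; lia.
move=> r s e; apply: (pcan_inj pickleK).
by move: (pickle r) (pickle s) e => x y; lia.
Qed.

Definition addr : reg -> Z := sval register_addresses.

Definition rd (m : memory) (r : reg) : Z := m (addr r).

Definition wrt (m : memory) (r : reg) (v : Z) : memory := upd m (addr r) v.

Lemma addr_inj : injective addr.
Proof. by case: (svalP register_addresses). Qed.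

Lemma addr_lt0 r : (addr r < 0)%Z.
Proof. by case: (svalP register_addresses). Qed.

Lemma rd_wrt m r v s : rd (wrt m r v) s = if s == r then v else rd m s.
Proof.
rewrite /rd /wrt /upd.
have [->|ne] := eqVneq; first by rewrite Z.eqb_refl.
case: Z.eqb_spec => // /addr_inj e.
by rewrite e eqxx in ne.
Qed.

Lemma wrt_heap m r v a : (0 <= a)%Z -> wrt m r v a = m a.
Proof.
move=> ha; rewrite /wrt /upd; case: Z.eqb_spec => // e.
have := addr_lt0 r; lia.
Qed.

Lemma rd_upd_heap m a v r : (0 <= a)%Z -> rd (upd m a v) r = rd m r.
Proof.
move=> ha; rewrite /rd /upd; case: Z.eqb_spec => // e.
have := addr_lt0 r; lia.
Qed.

(* Registers of class 0 hold constants: the compiled jumps and loops rely on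
   [rone], [rzero] and [rsize] containing 1, 0 and n. *)
Definition rone : reg := (0, 0, 0).
Definition rzero : reg := (0, 1, 0).
Definition rsize : reg := (0, 2, 0).

(** [CFor] is the only loop and always makes n rounds, so the running time can be read off the
    syntax. *)
Inductive cmd : Type :=
| CConst of reg & Z
| CAdd of reg & reg & reg
| CSub of reg & reg & reg
| CLoad of reg & reg
| CStore of reg & reg
| CSkip
| CSeq of cmd & cmd
| CIf of reg & reg & cmd & cmd
| CFor of reg & cmd.

(* [CStore] is guarded: a store to a negative address is ignored, so that it
   can never overwrite a register. *)
Fixpoint exec (n : nat) (c : cmd) (m : memory) : memory :=
  match c with
  | CConst r v => wrt m r v
  | CAdd r a b => wrt m r (rd m a + rd m b)%Z
  | CSub r a b => wrt m r (rd m a - rd m b)%Z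
  | CLoad r a => wrt m r (m (rd m a))
  | CStore a b => if (rd m a <? 0)%Z then m else upd m (rd m a) (rd m b)
  | CSkip => m
  | CSeq c1 c2 => exec n c2 (exec n c1 m)
  | CIf a b c1 c2 => if (rd m a <? rd m b)%Z then exec n c1 m else exec n c2 m
  | CFor x c =>
      iter n (fun m => let m' := exec n c m in wrt m' x (rd m' x + rd m' rone)%Z)
           (wrt m x 0%Z)
  end.

(** A store counts as writing no register; the guard in [exec] makes this sound. *)
Fixpoint writes_in (p : pred reg) (c : cmd) : bool :=
  match c with
  | CConst r _ | CAdd r _ _ | CSub r _ _ | CLoad r _ => p r
  | CStore _ _ | CSkip => true
  | CSeq c1 c2 | CIf _ _ c1 c2 => writes_in p c1 && writes_in p c2
  | CFor x c => p x && writes_in p c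
  end.

Fixpoint nostore (c : cmd) : bool :=
  match c with
  | CStore _ _ => false
  | CSeq c1 c2 | CIf _ _ c1 c2 => nostore c1 && nostore c2
  | CFor _ c => nostore c
  | _ => true
  end.

(** A body that changed its own counter would make the compiled test stop after a number of rounds
    other than n. *)
Fixpoint wf (c : cmd) : bool :=
  match c with
  | CSeq c1 c2 | CIf _ _ c1 c2 => wf c1 && wf c2
  | CFor x c => writes_in (predC1 x) c && wf c
  | _ => true
  end.

Fixpoint depth (c : cmd) : nat :=
  match c with
  | CSeq c1 c2 | CIf _ _ c1 c2 => maxn (depth c1) (depth c2)
  | CFor _ c => (depth c).+1
  | _ => 0
  end.

(** Both branches of a conditional are charged; this costs only a constant factor and keeps the
    bound independent of the memory. *)
Fixpoint cost (n : nat) (c : cmd) : nat :=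
  match c with
  | CStore _ _ => 2
  | CSkip => 0
  | CSeq c1 c2 => cost n c1 + cost n c2
  | CIf _ _ c1 c2 => 2 + cost n c1 + cost n c2
  | CFor _ c => 1 + n * (cost n c + 2)
  | _ => 1
  end.

Fixpoint len (c : cmd) : nat :=
  match c with
  | CStore _ _ => 2
  | CSkip => 0
  | CSeq c1 c2 => len c1 + len c2
  | CIf _ _ c1 c2 => len c2 + len c1 + 2
  | CFor _ c => len c + 3
  | _ => 1
  end.

(** Jump targets are absolute, hence the offset [o]. The else branch comes first because [IJlt]
    jumps on success, and comparing [rzero] with [rone] gives an unconditional jump. A loop tests at
    its end, so its body runs at least once: this is where [0 < n] enters later. *)
Fixpoint code (o : nat) (c : cmd) : program :=
  match c with
  | CConst r v => [:: IConst (addr r) v]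
  | CAdd r a b => [:: IAdd (addr r) (addr a) (addr b)]
  | CSub r a b => [:: ISub (addr r) (addr a) (addr b)]
  | CLoad r a => [:: ILoad (addr r) (addr a)]
  | CStore a b => [:: IJlt (addr a) (addr rzero) (o + 2); IStore (addr a) (addr b)]
  | CSkip => [::]
  | CSeq c1 c2 => code o c1 ++ code (o + len c1) c2
  | CIf a b c1 c2 =>
      [:: IJlt (addr a) (addr b) (o + len c2 + 2)] ++ code (o + 1) c2 ++
      [:: IJlt (addr rzero) (addr rone) (o + len c2 + len c1 + 2)] ++
      code (o + len c2 + 2) c1
  | CFor x c =>
      [:: IConst (addr x) 0] ++ code (o + 1) c ++
      [:: IAdd (addr x) (addr x) (addr rone); IJlt (addr x) (addr rsize) (o + 1)]
  end.

Lemma size_code o c : size (code o c) = len c.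
Proof.
elim: c o => //= [c1 h1 c2 h2|a b c1 h1 c2 h2|x c h] o;
  rewrite ?size_cat /= ?size_cat /= ?h1 ?h2 ?h; lia.
Qed.

Lemma writes_in_sub (p q : pred reg) c :
  subpred p q -> writes_in p c -> writes_in q c.
Proof.
move=> pq; elim: c => //=; try by move=> *; apply: pq.
- by move=> c1 h1 c2 h2 /andP[/h1-> /h2->].
- by move=> _ _ c1 h1 c2 h2 /andP[/h1-> /h2->].
- by move=> x c h /andP[/pq-> /h->].
Qed.

Lemma exec_frame n (p : pred reg) c m r :
  writes_in p c -> ~~ p r -> rd (exec n c m) r = rd m r.
Proof.
move=> + npr; have neq s : p s -> (r == s) = false.
  by move=> ps; apply: contraNF npr => /eqP->.
elim: c m => //=.
- by move=> s v m ps; rewrite rd_wrt neq.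
- by move=> s a b m ps; rewrite rd_wrt neq.
- by move=> s a b m ps; rewrite rd_wrt neq.
- by move=> s a m ps; rewrite rd_wrt neq.
- by move=> a b m _; case: Z.ltb_spec => // ha; rewrite rd_upd_heap.
- by move=> c1 h1 c2 h2 m /andP[w1 w2]; rewrite h2 // h1.
- by move=> a b c1 h1 c2 h2 m /andP[w1 w2]; case: ifP => _; [rewrite h1|rewrite h2].
- move=> x c h m /andP[px w].
  by elim: {1}n => [|i ih] /=; rewrite rd_wrt neq // h.
Qed.

Lemma exec_heap n c m a : nostore c -> (0 <= a)%Z -> exec n c m a = m a.
Proof.
move=> + ha; elim: c m => //=.
- by move=> r v m _; rewrite wrt_heap.
- by move=> r b c m _; rewrite wrt_heap.
- by move=> r b c m _; rewrite wrt_heap.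
- by move=> r b m _; rewrite wrt_heap.
- by move=> c1 h1 c2 h2 m /andP[w1 w2]; rewrite h2 // h1.
- by move=> r b c1 h1 c2 h2 m /andP[w1 w2]; case: ifP => _; [rewrite h1|rewrite h2].
- move=> x c h m w.
  by elim: {1}n => [|i ih] /=; rewrite wrt_heap // h.
Qed.

(** The body must preserve [rone] as well as the counter, since the increment reads it. *)
Lemma exec_for n (I : nat -> memory -> Prop) x c m :
  I 0 (wrt m x 0%Z) ->
  (forall i m, i < n -> I i m -> rd m x = Z.of_nat i ->
     [/\ rd (exec n c m) x = Z.of_nat i, rd (exec n c m) rone = 1%Z &
         I i.+1 (wrt (exec n c m) x (Z.of_nat i.+1))]) ->
  I n (exec n (CFor x c) m).
Proof.
move=> i0 istep /=.
suff h j : j <= n -> let m' := iter j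
    (fun m => let m' := exec n c m in wrt m' x (rd m' x + rd m' rone)%Z)
    (wrt m x 0%Z) in I j m' /\ rd m' x = Z.of_nat j by case: (h n).
elim: j => [_|j ih jn] /=; first by rewrite rd_wrt eqxx.
have [ij xj] := ih (ltnW jn).
have [-> -> h] := istep _ _ jn ij xj.
have -> : (Z.of_nat j + 1 = Z.of_nat j.+1)%Z by lia.
by rewrite rd_wrt eqxx.
Qed.

(** * Machine runs and correctness of compiled code *)

#[local] Arguments step : simpl never.

(** [run] only speaks of halting runs, which do not compose; this relation counts the steps of a
    partial run. *)
Fixpoint steps (P : program) (t : nat) (c c' : nat * memory) : Prop :=
  match t with
  | 0 => c = c'
  | t'.+1 => exists2 c1, step P c = Some c1 & steps P t' c1 c'
  end.

Lemma steps_trans P t1 t2 a b c :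
  steps P t1 a b -> steps P t2 b c -> steps P (t1 + t2) a c.
Proof.
elim: t1 a => [|t1 ih] a /=; first by move=> ->.
by move=> [a1 h1 h2] h3; exists a1 => //; apply: ih.
Qed.

Lemma run_steps P t t' c pc m :
  steps P t c (pc, m) -> t <= t' -> size P <= pc -> run P t' c = Some m.
Proof.
move=> + + hpc; elim: t t' c => [|t ih] t' c /=.
  by move=> -> _; case: t' => [|t'] /=; rewrite /step ltnNge hpc.
by move=> [c1 h1 h2]; case: t' => // t' ltt /=; rewrite h1; apply: ih.
Qed.

Definition code_at (P : program) (o : nat) (C : program) : Prop :=
  exists P1 P2, P = P1 ++ C ++ P2 /\ size P1 = o.

Lemma code_at_catl P o C1 C2 : code_at P o (C1 ++ C2) -> code_at P o C1.
Proof. by move=> [P1 [P2 [-> <-]]]; exists P1, (C2 ++ P2); rewrite -catA. Qed.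

Lemma code_at_catr P o C1 C2 :
  code_at P o (C1 ++ C2) -> code_at P (o + size C1) C2.
Proof.
by move=> [P1 [P2 [-> <-]]]; exists (P1 ++ C1), P2; rewrite -!catA size_cat.
Qed.

Lemma step_at P o i C m : code_at P o (i :: C) ->
  step P (o, m) = Some
    match i with
    | IConst a v => (o.+1, upd m a v)
    | IAdd a b c => (o.+1, upd m a (m b + m c)%Z)
    | ISub a b c => (o.+1, upd m a (m b - m c)%Z)
    | ILoad a b => (o.+1, upd m a (m (m b)))
    | IStore a b => (o.+1, upd m (m a) (m b))
    | IJlt a b l => if Z.ltb (m a) (m b) then (l, m) else (o.+1, m)
    end.
Proof.
move=> [P1 [P2 [-> <-]]]; rewrite /step.
by rewrite size_cat /= addnS ltnS leq_addr nth_cat ltnn subnn.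
Qed.

Definition consts_ok (n : nat) (m : memory) : Prop :=
  [/\ rd m rone = 1%Z, rd m rzero = 0%Z & rd m rsize = Z.of_nat n].

Definition nonconst : pred reg := fun r => r.1.1 != 0.

Lemma exec_consts n c m :
  writes_in nonconst c -> consts_ok n m -> consts_ok n (exec n c m).
Proof. by move=> w [h1 h2 h3]; split; rewrite (exec_frame _ _ w). Qed.

Lemma wrt_consts n m r v :
  nonconst r -> consts_ok n m -> consts_ok n (wrt m r v).
Proof. by move: r => [[[//|r0] r1] r2] _ [h1 h2 h3]; split; rewrite rd_wrt. Qed.

(** Induction on the command; only a loop needs an inner induction, on the number of completed
    rounds. *)
Lemma code_steps n P c o m :
  0 < n -> wf c -> writes_in nonconst c -> consts_ok n m ->
  code_at P o (code o c) ->
  exists2 t, t <= cost n c & steps P t (o, m) (o + len c, exec n c m).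
Proof.
move=> n0; elim: c o m => /=.
- move=> r v o m _ _ _ at_; exists 1 => //; exists (o + 1, exec n (CConst r v) m) => //.
  by rewrite (step_at _ at_) addn1.
- move=> r a b o m _ _ _ at_; exists 1 => //; exists (o + 1, exec n (CAdd r a b) m) => //.
  by rewrite (step_at _ at_) addn1.
- move=> r a b o m _ _ _ at_; exists 1 => //; exists (o + 1, exec n (CSub r a b) m) => //.
  by rewrite (step_at _ at_) addn1.
- move=> r a o m _ _ _ at_; exists 1 => //; exists (o + 1, exec n (CLoad r a) m) => //.
  by rewrite (step_at _ at_) addn1.
- move=> a b o m _ _ [_ h0 _] at_.
  have := step_at m at_; rewrite -/(rd m a) -/(rd m rzero) h0.
  case: ifP => _ h; first by exists 1 => //; exists (o + 2, m).
  exists 2 => //; exists (o.+1, m) => //.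
  exists (o + 2, upd m (rd m a) (rd m b)) => //.
  move: at_; rewrite -cat1s => /code_at_catr; rewrite addn1 => at_.
  by rewrite (step_at _ at_) addn2.
- by move=> o m _ _ _ _; exists 0 => //; rewrite addn0.
- move=> c1 h1 c2 h2 o m /andP[wf1 wf2] /andP[w1 w2] cm at_.
  have [t1 le1 s1] := h1 _ _ wf1 w1 cm (code_at_catl at_).
  move: at_ => /code_at_catr; rewrite size_code => at_.
  have [t2 le2 s2] := h2 _ _ wf2 w2 (exec_consts w1 cm) at_.
  exists (t1 + t2); first exact: leq_add.
  by rewrite addnA; apply: steps_trans s1 s2.
- move=> a b c1 h1 c2 h2 o m /andP[wf1 wf2] /andP[w1 w2] cm at_.
  have := step_at m at_; rewrite -/(rd m a) -/(rd m b) -cat1s in at_ *.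
  move: at_ => /code_at_catr /= at_.
  have at2 := code_at_catl at_.
  move: at_ => /code_at_catr; rewrite size_code => at_.
  case: ifP => _ st.
    move: at_; rewrite -cat1s => /code_at_catr /=.
    have -> : o + 1 + len c2 + 1 = o + len c2 + 2 by lia.
    move=> /(h1 _ m wf1 w1 cm)[t le1 s1].
    exists t.+1; first lia.
    exists (o + len c2 + 2, m) => //.
    by have -> : o + (len c2 + len c1 + 2) = o + len c2 + 2 + len c1 by lia.
  have [t le2 s2] := h2 _ m wf2 w2 cm at2.
  exists (1 + (t + 1)); first lia.
  exists (o + 1, m); first by rewrite addn1.
  apply: steps_trans s2 _.
  have [h10 h00 _] := exec_consts w2 cm.
  have := step_at (exec n c2 m) at_; rewrite -/(rd _ rzero) -/(rd _ rone) h10 h00 /= => ->.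
  by eexists; first reflexivity; congr (_, _); lia.
- move=> x c h o m /andP[nx wfc] /andP[cx w] cm at_.
  have st0 := step_at m at_; rewrite -cat1s in at_.
  move: at_ => /code_at_catr /= at_.
  have atc := code_at_catl at_.
  move: at_ => /code_at_catr; rewrite size_code => at_.
  pose f m := let m' := exec n c m in wrt m' x (rd m' x + rd m' rone)%Z.
  (* After round [j] the final test has been executed as well, so the machine stands at the body
     again or, after the last round, behind the loop. *)
  suff main j : j < n -> exists2 t, t <= j.+1 * (cost n c + 2) & 
    [/\ consts_ok n (iter j.+1 f (wrt m x 0)),
      rd (iter j.+1 f (wrt m x 0)) x = Z.of_nat j.+1 &
      steps P t (o + 1, wrt m x 0)
        (if j.+1 < n then o + 1 else o + (len c + 3), iter j.+1 f (wrt m x 0))].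
    case: n n0 @f cm main h => // n _ f cm main _.
    have [t le [_ _ s]] := main n (leqnn _).
    exists t.+1; first by [].
    exists (o + 1, wrt m x 0); first by rewrite st0 addn1.
    by move: s; rewrite ltnn.
  have body i m' : i < n -> consts_ok n m' -> rd m' x = Z.of_nat i ->
      consts_ok n (f m') /\ rd (f m') x = Z.of_nat i.+1 /\
      exists2 t, t <= cost n c + 2 & steps P t (o + 1, m')
        (if i.+1 < n then o + 1 else o + (len c + 3), f m').
    move=> ltin cm' xi.
    have cm1 := exec_consts w cm'.
    have x1 : rd (exec n c m') x = Z.of_nat i.
      by rewrite (exec_frame _ _ nx) //= eqxx.
    have cm2 : consts_ok n (f m') by apply: wrt_consts.
    have x2 : rd (f m') x = Z.of_nat i.+1.
      by rewrite /f rd_wrt eqxx x1; case: cm1 => -> _ _; lia.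
    split => //; split => //.
    have [t le s] := h _ _ wfc w cm' atc.
    exists (t + 2); first lia.
    apply: steps_trans s _.
    exists ((o + 1 + len c).+1, f m'); first by rewrite (step_at _ at_).
    move: at_; rewrite -cat1s => /code_at_catr /=; rewrite addn1 => at_.
    have := step_at (f m') at_; rewrite -/(rd _ x) -/(rd _ rsize) x2.
    case: cm2 => _ _ ->; case: Z.ltb_spec => hlt -> /=; eexists; try reflexivity.
      by have -> : i.+1 < n by lia.
    have -> : (i.+1 < n) = false by lia.
    by congr (_, _); lia.
  elim: j => [_|j ih jn].
    have x0 : rd (wrt m x 0) x = Z.of_nat 0 by rewrite rd_wrt eqxx.
    have [b1 [b2 [t le s]]] := body 0 _ n0 (wrt_consts _ cx cm) x0.
    by exists t; [rewrite mul1n|split].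
  have [t le [b1 b2 s]] := ih (ltnW jn).
  have [c1 [c2 [t' le' s']]] := body j.+1 _ jn b1 b2.
  exists (t + t'); first by rewrite mulSn addnC; apply: leq_add.
  split => //; apply: steps_trans s _.
  by rewrite jn.
Qed.

(** The cost is a polynomial in n with natural coefficients and degree at most [depth c]; its value
    at 1 is the sum of the coefficients. *)
Lemma cost_bound n c : 0 < n -> cost n c <= cost 1 c * n ^ depth c.
Proof.
move=> n0; elim: c => //=.
- move=> c1 h1 c2 h2; rewrite mulnDl; apply: leq_add.
    by apply: (leq_trans h1); rewrite leq_mul // leq_pexp2l // leq_maxl.
  by apply: (leq_trans h2); rewrite leq_mul // leq_pexp2l // leq_maxr.
- move=> a b c1 h1 c2 h2; rewrite !mulnDl; apply: leq_add; first apply: leq_add.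
  + by rewrite leq_pmulr // expn_gt0 n0.
  + by apply: (leq_trans h1); rewrite leq_mul // leq_pexp2l // leq_maxl.
  + by apply: (leq_trans h2); rewrite leq_mul // leq_pexp2l // leq_maxr.
- move=> x c h; rewrite mulnDl mul1n; apply: leq_add; first by rewrite expn_gt0 n0.
  rewrite mul1n expnS mulnCA leq_mul2l mulnDl; apply/orP; right.
  by apply: leq_add => //; rewrite leq_pmulr // expn_gt0 n0.
Qed.

(** * Gluing paths into a cycle *)

Definition path_edges (s : seq nat) : seq (nat * nat) :=
  if s is x :: s' then pairmap edge x s' else [::].

(** Polymorphic, because the same cyclic pairing serves vertices (edges of a tour), segments (joins)
    and words (symbolic joins). *)
Definition cycle_pairs (A B : Type) (h : A -> A -> B) (s : seq A) : seq B :=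
  if s is x :: s' then pairmap h x (rcons s' x) else [::].

Definition cycle_edges : seq nat -> seq (nat * nat) := cycle_pairs edge.

Definition link (A B : seq nat) : nat * nat := edge (last 0 A) (head 0 B).

Lemma edgeC u v : edge u v = edge v u.
Proof. by rewrite /edge minnC maxnC. Qed.

Lemma edge_inj2 u v x y : edge u v = edge x y -> (u = x /\ v = y) \/ (u = y /\ v = x).
Proof. rewrite /edge => -[]; lia. Qed.

Lemma edge_mem (p : pred nat) u v : p u -> p v -> p (edge u v).1 && p (edge u v).2.
Proof. by move=> pu pv; rewrite /edge /minn /maxn; case: ltnP; rewrite /= pu pv. Qed.

Lemma pairmap_iota (A B : Type) (h : A -> A -> B) (f : nat -> A) c j :
  pairmap h (f c) (map f (iota c.+1 j)) = [seq h (f x) (f x.+1) | x <- iota c j].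
Proof. by elim: j c => //= j ih c; rewrite ih. Qed.

Lemma iotaSr c n : iota c n.+1 = rcons (iota c n) (c + n).
Proof. by rewrite -addn1 iotaD cats1. Qed.

Lemma cycle_pairs_iota (A B : Type) (h : A -> A -> B) (f : nat -> A) c n :
  f (c + n) = f c ->
  cycle_pairs h (map f (iota c n)) = [seq h (f x) (f x.+1) | x <- iota c n].
Proof.
case: n => // n e.
have -> : cycle_pairs h (map f (iota c n.+1)) =
    pairmap h (f c) (map f (iota c.+1 n.+1)); last by rewrite pairmap_iota.
by rewrite (iotaSr c.+1) map_rcons /= addSnnS e.
Qed.

Lemma perm_map_iota_periodic (A : eqType) (g : nat -> A) n c :
  (forall x, g (x + n) = g x) -> perm_eq (map g (iota c n)) (map g (iota 0 n)).
Proof.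
move=> per; elim: c => // c /(perm_trans _); apply.
case: n per => // n per.
by rewrite iotaSr map_rcons perm_rcons addSnnS per.
Qed.

Lemma path_edges_cat A B : A != [::] -> B != [::] ->
  path_edges (A ++ B) = path_edges A ++ link A B :: path_edges B.
Proof. by case: A => // x A _; case: B => // y B _ /=; rewrite pairmap_cat. Qed.

Lemma cycle_edges_rcons s : s != [::] ->
  cycle_edges s = rcons (path_edges s) (link s s).
Proof.
by case: s => // x s _; rewrite /cycle_edges /= -!cats1 pairmap_cat.
Qed.

Lemma flatten_nil_cons (A : seq nat) L : A != [::] -> flatten (A :: L) != [::].
Proof. by case: A. Qed.

Lemma last_flatten A L : all (fun B => B != [::]) (A :: L) ->
  last 0 (flatten (A :: L)) = last 0 (last A L).
Proof.
elim: L A => [|B L ih] A /=; first by rewrite cats0.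
move=> /and3P[hA hB hL]; rewrite last_cat.
have := ih B; rewrite /= hB hL => <- //.
by case: B hB {ih}.
Qed.

Lemma path_edges_flatten A L : all (fun B => B != [::]) (A :: L) ->
  perm_eq (path_edges (flatten (A :: L)))
    (flatten (map path_edges (A :: L)) ++ pairmap link A L).
Proof.
elim: L A => [|B L ih] A; first by rewrite /= !cats0.
move=> /andP[hA hL].
rewrite -[flatten (A :: _)]/(A ++ flatten (B :: L)) path_edges_cat //; last first.
  by apply: flatten_nil_cons; case/andP: hL.
have -> : link A (flatten (B :: L)) = link A B.
  by move: hL => /andP[+ _]; case: B {ih}.
rewrite [pairmap _ _ _]/= [map _ _]/= -[flatten (path_edges A :: _)]/(_ ++ _).
rewrite -catA perm_cat2l perm_sym.
rewrite perm_catC /= perm_cons perm_catC perm_sym; exact: ih.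
Qed.

Lemma cycle_edges_flatten L : all (fun B => B != [::]) L -> 
  perm_eq (cycle_edges (flatten L))
    (flatten (map path_edges L) ++ cycle_pairs link L).
Proof.
case: L => // A L hL; have /andP[hA _] := hL.
rewrite cycle_edges_rcons; last exact: flatten_nil_cons.
have -> : link (flatten (A :: L)) (flatten (A :: L)) = link (last A L) A.
  by rewrite /link last_flatten //; case: A hA {hL}.
rewrite /cycle_pairs -[rcons L A]cats1 pairmap_cat /= -cats1 catA perm_cat2r.
exact: path_edges_flatten.
Qed.

Lemma path_edges_rev s : perm_eq (path_edges (rev s)) (path_edges s).
Proof.
elim: s => // x [//|y s] ih.
rewrite rev_cons -cats1 path_edges_cat //; last first.
  by rewrite -size_eq0 size_rev.
rewrite cats1 perm_rcons /link /= rev_cons last_rcons edgeC perm_cons.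
by rewrite -rev_cons.
Qed.

(** * Rearranged segments, and how to read an arrangement off a path *)

Definition orient (b : bool) (s : seq nat) : seq nat := if b then rev s else s.

Definition arrange (L : nat -> seq nat) (w : seq (nat * bool)) : seq (seq nat) :=
  [seq orient x.2 (L x.1) | x <- w].

Lemma perm_orient b s : perm_eq (orient b s) s.
Proof. by case: b => //=; rewrite perm_rev. Qed.

Lemma path_edges_orient b s : perm_eq (path_edges (orient b s)) (path_edges s).
Proof. by case: b => //=; rewrite path_edges_rev. Qed.

Lemma orient_nil b s : (orient b s != [::]) = (s != [::]).
Proof. by case: b => //=; rewrite -!size_eq0 size_rev. Qed.

Lemma perm_flatten_map (A B : eqType) (F G : A -> seq B) s :
  (forall x, perm_eq (F x) (G x)) ->
  perm_eq (flatten (map F s)) (flatten (map G s)).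
Proof. by move=> h; elim: s => //= x s ih; apply: perm_cat. Qed.

Lemma perm_arrange L w I : perm_eq (map fst w) I ->
  perm_eq (flatten (arrange L w)) (flatten (map L I)).
Proof.
move=> h; apply: perm_trans _ (perm_flatten (perm_map L h)); rewrite -map_comp.
by apply: perm_flatten_map => x; apply: perm_orient.
Qed.

Lemma path_edges_arrange L w I : perm_eq (map fst w) I ->
  perm_eq (flatten (map path_edges (arrange L w)))
          (flatten (map path_edges (map L I))).
Proof.
move=> h; apply: perm_trans _ (perm_flatten (perm_map _ (perm_map L h))).
rewrite -!map_comp.
by apply: perm_flatten_map => x; apply: path_edges_orient.
Qed.

Lemma path_edges_mem s e : e \in path_edges s -> (e.1 \in s) && (e.2 \in s).
Proof.
case: s => // x s; elim: s x => //= y s ih x; rewrite inE => /orP[/eqP->|/ih].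
  by apply: (@edge_mem (fun z => z \in [:: x, y & s])); rewrite !inE eqxx ?orbT.
by move=> /andP[h1 h2]; rewrite !(in_cons x) h1 h2 !orbT.
Qed.

(** The first vertex of a simple path lies on only one of its edges, so [S] is forced to take the
    same first step as [s]; the rest is induction. *)
Lemma path_prefix x S s : uniq (x :: S) -> uniq (x :: s) ->
  {subset path_edges (x :: S) <= path_edges (x :: s)} ->
  exists s', x :: s = (x :: S) ++ s'.
Proof.
elim: S x s => [|y S ih] x s; first by exists s.
move=> uS us sub.
have xy : edge x y \in path_edges (x :: s) by apply: sub; rewrite /= mem_head.
case: s us sub xy => // z s us sub.
have nx e : e \in path_edges (z :: s) -> (e.1 != x) && (e.2 != x).
  move=> /path_edges_mem/andP[h1 h2]; move: us => /andP[xs _].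
  by apply/andP; split; apply: contraNneq xs => <-.
rewrite /= inE => /orP[/eqP/edge_inj2 h|/nx]; last first.
  by rewrite /edge /minn /maxn; case: ltnP; rewrite /= eqxx ?andbF.
have ez : y = z.
  move: h us => [[_ //]|[-> ->]] /=; by rewrite inE eqxx.
case: _ / ez in us sub nx *.
have [||//|s' e] := ih y s; [by case/andP: uS|by case/andP: us| |].
  move=> e eS; have := sub e; rewrite [path_edges (x :: y :: S)]/= inE eS orbT => /(_ isT).
  rewrite [path_edges _]/= inE => /orP[/eqP ee|//].
  move: eS => /path_edges_mem/andP[]; rewrite ee.
  move: uS => /andP[xS _].
  by rewrite /edge /minn /maxn; case: ltnP => _ /= h1 h2; move: xS; rewrite ?h1 ?h2.
by exists s'; rewrite e.
Qed.

(** If [x] were interior to [S], its two distinct neighbours there would both be neighbours of [x]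
    in [x :: s], where the first vertex has only one. *)
Lemma path_head_end x s S : uniq S -> uniq (x :: s) -> x \in S ->
  {subset path_edges S <= path_edges (x :: s)} ->
  exists b S', orient b S = x :: S'.
Proof.
move=> uS us /splitPr xS; case: xS uS => S1 S2 uS sub.
case: S1 uS sub => [|a S1] uS sub; first by exists false, S2.
case/lastP: S2 uS sub => [|S2 c] uS sub.
  by exists true, (rev (a :: S1)); rewrite /orient cats1 rev_rcons.
exfalso.
have one_nb y : edge x y \in path_edges (x :: s) -> y = head 0 s.
  case: s us {sub} => // z s /andP[xs _] /=; rewrite inE.
  move=> /orP[/eqP/edge_inj2[[_ ->]//|[xz _]]|].
    by rewrite xz inE eqxx in xs.
  move=> /(@path_edges_mem (z :: s))/andP[].
  by rewrite /edge /minn /maxn; case: ltnP => _ /= h1 h2; move: xs; rewrite ?h1 ?h2.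
have n2 : rcons S2 c != [::] by case: (S2).
have e1 : last a S1 = head 0 s.
  apply: one_nb; apply: sub; rewrite path_edges_cat //.
  by rewrite mem_cat inE /link /= edgeC eqxx orbT.
have e2 : head 0 (rcons S2 c) = head 0 s.
  apply: one_nb; apply: sub; rewrite -[x :: rcons _ _]cat1s catA path_edges_cat //.
  by rewrite mem_cat inE /link last_cat /= eqxx orbT.
have m1 : head 0 s \in a :: S1 by rewrite -e1 mem_last.
have m2 : head 0 s \in rcons S2 c.
  by rewrite -e2; case: (S2) => [|? ?]; rewrite /= mem_head.
move: uS; rewrite cat_uniq => /and3P[_ /negP h _]; apply: h.
by apply/hasP; exists (head 0 s) => //; rewrite inE m2 orbT.
Qed.

(** The first vertex of [s] lies in some segment, is an end of it by [path_head_end], and the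
    segment so oriented is a prefix of [s] by [path_prefix]. Peel it off and continue with the
    remaining segments. *)
Lemma arrange_of_path (L : nat -> seq nat) I s :
  uniq I -> uniq s -> (forall i, i \in I -> L i != [::]) ->
  perm_eq s (flatten (map L I)) ->
  (forall i, i \in I -> {subset path_edges (L i) <= path_edges s}) ->
  exists2 w, perm_eq (map fst w) I & s = flatten (arrange L w).
Proof.
elim: {I}(size I) {-2}I (erefl (size I)) s => [|N ih] I sI s uI us nL ps sub.
  move/eqP: sI ps; rewrite size_eq0 => /eqP-> /perm_nilP->.
  by exists [::].
case: s us ps sub => [|v s] us ps sub.
  case: I sI nL ps {uI sub} => // i I _ nL; rewrite perm_sym => /perm_nilP /=.
  have := nL i (mem_head _ _); by case: (L i).
have : v \in flatten (map L I) by rewrite -(perm_mem ps) mem_head.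
move=> /flattenP[S /mapP[i iI ->] vi].
have ufl : uniq (flatten (map L I)) by rewrite -(perm_uniq ps).
have pI := perm_to_rem iI.
have pfl : perm_eq (flatten (map L I)) (L i ++ flatten (map L (rem i I))).
  exact: (perm_flatten (perm_map L pI)).
have ui : uniq (L i) by move: ufl; rewrite (perm_uniq pfl) cat_uniq => /andP[].
have [b [S' eS]] := path_head_end ui us vi (sub i iI).
have uS : uniq (v :: S') by rewrite -eS (perm_uniq (perm_orient b _)).
have [|s' es] := path_prefix uS us.
  by rewrite -eS => e; rewrite (perm_mem (path_edges_orient b _)) => /(sub i iI).
have ps' : perm_eq s' (flatten (map L (rem i I))).
  move: ps; rewrite es -eS => h; rewrite -(perm_cat2l (L i)) -(permPr pfl).
  by rewrite -(permPr h) perm_cat2r perm_sym perm_orient.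
have us' : uniq s' by move: us; rewrite es cat_uniq => /and3P[].
have [||||||w pw ew] := ih (rem i I) _ s'.
- by rewrite size_rem // sI.
- exact: rem_uniq.
- exact: us'.
- by move=> j /mem_rem; apply: nL.
- exact: ps'.
(* Edges of another segment survive the peeling: their endpoints avoid the prefix, so they are
   neither inside it nor the edge that leaves it. *)
- move=> j jI e ej.
  have ms x : x \in L j -> x \in s'.
    move=> xj; rewrite (perm_mem ps'); apply/flattenP.
    by exists (L j) => //; apply: map_f.
  have disj x : x \in s' -> x \notin v :: S'.
    move=> xs; move: us; rewrite es cat_uniq => /and3P[_ /hasPn h _].
    exact: h.
  have /andP[e1 e2] := path_edges_mem ej.
  have d1 := disj _ (ms _ e1); have d2 := disj _ (ms _ e2).
  have := sub j (mem_rem jI) e ej; rewrite es.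
  have n' : s' != [::] by case: (s') (ms _ e1).
  rewrite path_edges_cat // mem_cat inE => /or3P[|/eqP ee|//].
    by move=> /path_edges_mem; rewrite (negPf d1).
  move: d1 d2; rewrite ee /link /edge /minn /maxn.
  by case: ltnP => _ /=; rewrite mem_last.
exists ((i, b) :: w).
  by rewrite /= perm_sym (permPl pI) perm_cons perm_sym.
by rewrite es /= -ew eS.
Qed.

(** * Moves and words *)

Definition vat (n : nat) (T : seq nat) (x : nat) : nat := nth 0 T (x %% n).

(* The slot (j, b) stands for the endpoint T[p_j + b] of the removed edge
   {T[p_j], T[p_j + 1]}. *)
Definition slot : Type := (nat * bool)%type.

Definition vtx (n : nat) (T : seq nat) (p : nat -> nat) (a : slot) : nat :=
  vat n T (p a.1 + a.2).

Definition removed (k n : nat) (T : seq nat) (p : nat -> nat) : seq (nat * nat) :=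
  [seq edge (vtx n T p (i, false)) (vtx n T p (i, true)) | i <- iota 0 k].

Definition added (n : nat) (T : seq nat) (p : nat -> nat) (sg : seq (slot * slot)) :
    seq (nat * nat) :=
  [seq edge (vtx n T p x.1) (vtx n T p x.2) | x <- sg].

Definition increasing (k : nat) (p : nat -> nat) : Prop :=
  forall i j, i < j -> j < k -> p i < p j.

(* The i-th segment runs from T[p_{i-1} + 1] to T[p_i] (indices mod k); a word
   lists the segments in their new cyclic order, true meaning reversed. *)
Definition is_word (k : nat) (w : seq (nat * bool)) : Prop :=
  perm_eq (map fst w) (iota 0 k).

(** An unreversed segment i ends at T[p_i], a reversed one at T[p_{i-1} + 1]; adding [k.-1] is
    subtracting 1 modulo k. *)
Definition slot_last (k : nat) (x : nat * bool) : slot :=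
  if x.2 then ((x.1 + k.-1) %% k, true) else (x.1, false).

Definition slot_head (k : nat) (x : nat * bool) : slot := slot_last k (x.1, ~~ x.2).

(** The added edges with the positions left symbolic: this is all that the program text has to know
    of a word. *)
Definition signature (k : nat) : seq (nat * bool) -> seq (slot * slot) :=
  cycle_pairs (fun x y => (slot_last k x, slot_head k y)).

Lemma vatDn n T x : vat n T (x + n) = vat n T x.
Proof. by rewrite /vat modnDr. Qed.

Lemma tour_edgesE n T :
  tour_edges n T = [seq edge (vat n T x) (vat n T x.+1) | x <- iota 0 n].
Proof.
apply/eq_in_map => i; rewrite mem_iota add0n => /andP[_ lt].
by rewrite /vat (modn_small lt) addn1.
Qed.

Section Tour.

Variables (n : nat) (T : seq nat).
Hypothesis tourT : is_tour n T.

Local Notation va := (vat n T).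

Lemma tour_size : size T = n.
Proof. by case: tourT => _ /perm_size; rewrite size_iota. Qed.

Lemma tour_uniq : uniq T.
Proof. by case: tourT => _ /perm_uniq->; apply: iota_uniq. Qed.

Lemma tour_gt2 : 2 < n.
Proof. by case: tourT. Qed.

Lemma tour_nth_lt i : i < n -> nth 0 T i < n.
Proof.
move=> lt; have : nth 0 T i \in T by rewrite mem_nth // tour_size.
by case: tourT => _ /perm_mem->; rewrite mem_iota.
Qed.

Lemma vat_lt x : va x < n.
Proof. by apply: tour_nth_lt; rewrite ltn_mod; have := tour_gt2; lia. Qed.

Lemma vat_inj x y : va x = va y -> x = y %[mod n].
Proof.
have n0 : 0 < n by have := tour_gt2; lia.
by move=> /eqP; rewrite nth_uniq ?tour_uniq ?tour_size ?ltn_mod // => /eqP.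
Qed.

Lemma tour_iota : map va (iota 0 n) = T.
Proof.
apply: (@eq_from_nth _ 0); first by rewrite size_map size_iota tour_size.
move=> i; rewrite size_map size_iota => lt.
by rewrite (nth_map 0) ?size_iota // nth_iota // /vat modn_small.
Qed.

Lemma tour_rotate c : perm_eq (map va (iota c n)) T.
Proof.
by apply: perm_trans (perm_map_iota_periodic _ (vatDn n T)) _; rewrite tour_iota.
Qed.

Lemma tour_edges_rotate c :
  perm_eq (cycle_edges (map va (iota c n))) (tour_edges n T).
Proof.
rewrite /cycle_edges cycle_pairs_iota ?vatDn // tour_edgesE.
by apply: perm_map_iota_periodic => x; rewrite -addSn !vatDn.
Qed.

Lemma tour_edge_inj x y : x < n -> y < n ->
  edge (va x) (va x.+1) = edge (va y) (va y.+1) -> x = y.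
Proof.
move=> ltx lty /edge_inj2[[/vat_inj + _]|[/vat_inj h1 /vat_inj h2]].
  by rewrite !modn_small.
have n2 := tour_gt2.
(* Two steps of the tour traversing one edge in opposite directions would return to the start after
   two steps, which n >= 3 excludes. *)
have : x + 2 = x + 0 %[mod n].
  by rewrite addn0 h1 -[y.+1]addn1 -[in RHS]modnDml -h2 modnDml addn1 addn2.
move=> /eqP; rewrite eqn_modDl => /eqP; rewrite mod0n modn_small //.
Qed.

Lemma tour_edges_uniq : uniq (tour_edges n T).
Proof.
rewrite tour_edgesE map_inj_in_uniq ?iota_uniq // => x y.
by rewrite !mem_iota !add0n /= => ltx lty; apply: tour_edge_inj.
Qed.

Lemma tour_edges_edge : all (is_edge n) (tour_edges n T).
Proof.
rewrite tour_edgesE; apply/allP => e /mapP[x _ ->].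
have l1 := vat_lt x; have l2 := vat_lt x.+1.
have ne : va x <> va x.+1.
  move=> /vat_inj ex; have : x + 0 = x + 1 %[mod n] by rewrite addn0 addn1.
  move=> /eqP; rewrite eqn_modDl mod0n modn_small //.
  by have := tour_gt2; lia.
by rewrite /is_edge /edge /=; lia.
Qed.

End Tour.

(** * The segments between removed edges, and the moves that words describe *)

Section Segments.

Variables (n : nat) (T : seq nat) (k : nat) (p : nat -> nat).
Hypotheses (tourT : is_tour n T) (k0 : 0 < k).
Hypotheses (incp : increasing k p) (ltp : forall i, i < k -> p i < n).

Local Notation va := (vat n T).
Local Notation vx := (vtx n T p).

(* The removed positions, unrolled to an increasing sequence on all of nat. *)
Definition unrolled (x : nat) : nat := p (x %% k) + x %/ k * n.

(** Taken one turn later, with [i + k.-1] and [i + k] in place of i - 1 and i, so that index 0 has a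
    predecessor in nat. *)
Definition segment (i : nat) : seq nat :=
  map va (iota (unrolled (i + k.-1)).+1 (unrolled (i + k) - unrolled (i + k.-1))).

Lemma unrolled_lt x : unrolled x < unrolled x.+1.
Proof.
have e : x.+1 = x %/ k * k + (x %% k).+1 by rewrite addnS -divn_eq.
rewrite /unrolled e.
have ltk : x %% k < k by rewrite ltn_mod.
have [lt|ge] := ltnP (x %% k).+1 k.
  rewrite modnMDl (modn_small lt) divnMDl // (divn_small lt) addn0 ltn_add2r.
  exact: incp.
(* Wrap-around: the next position is p_0 shifted by n, and p_{k-1} < n. *)
have -> : (x %% k).+1 = k by lia.
rewrite -mulSnr modnMl mulnK // mulSnr.
have := ltp ltk; lia.
Qed.

Lemma unrolledDk x : unrolled (x + k) = unrolled x + n.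
Proof. by rewrite /unrolled modnDr divnDr // divnn k0 addn1 mulSnr addnA. Qed.

Lemma vat_unrolled x b : va (unrolled x + b) = va (p (x %% k) + b).
Proof. by rewrite /unrolled /vat addnAC -modnDmr modnMl addn0. Qed.

Lemma size_segment i : 0 < size (segment i).
Proof.
rewrite size_map size_iota subn_gt0.
have -> : i + k = (i + k.-1).+1 by lia.
exact: unrolled_lt.
Qed.

Lemma segment_nil i : segment i != [::].
Proof. by rewrite -size_eq0 -lt0n size_segment. Qed.

Lemma head_segment i : head 0 (segment i) = vx ((i + k.-1) %% k, true).
Proof.
have := size_segment i; rewrite /segment size_map size_iota.
case: (_ - _) => // j _ /=.
by rewrite -addn1 vat_unrolled.
Qed.

Lemma last_segment i : last 0 (segment i) = vx (i %% k, false).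
Proof.
have := size_segment i; rewrite size_map size_iota subn_gt0 => lt.
have := size_segment i; rewrite size_map size_iota /segment.
case E : (_ - _) => [//|j] _; rewrite iotaSr map_rcons last_rcons.
have -> : (unrolled (i + k.-1)).+1 + j = unrolled (i + k) by lia.
by rewrite -[unrolled _]addn0 vat_unrolled modnDr.
Qed.

Lemma segment_k : segment k = segment 0.
Proof.
rewrite /segment !add0n [k + k.-1]addnC !unrolledDk subnDr -addSn.
rewrite [_.+1 + n]addnC iotaDl -map_comp.
by apply: eq_map => x /=; rewrite addnC vatDn.
Qed.

Lemma flatten_segments j :
  flatten (map segment (iota 0 j)) =
  map va (iota (unrolled k.-1).+1 (unrolled (j + k.-1) - unrolled k.-1)).
Proof.
elim: j => [|j ih]; first by rewrite subnn.
rewrite iotaSr map_rcons flatten_rcons ih add0n /segment -map_cat.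
have mono : unrolled k.-1 <= unrolled (j + k.-1).
  elim: (j) => // i h; apply: (leq_trans h); rewrite addSn; exact/ltnW/unrolled_lt.
have lt := unrolled_lt (j + k.-1).
have -> : j + k = (j + k.-1).+1 by lia.
rewrite addSn; congr (map _ _).
have -> : unrolled (j + k.-1).+1 - unrolled k.-1 =
  (unrolled (j + k.-1) - unrolled k.-1) +
  (unrolled (j + k.-1).+1 - unrolled (j + k.-1)) by lia.
by rewrite iotaD; congr (_ ++ iota _ _); lia.
Qed.

Lemma flatten_segmentsk :
  flatten (map segment (iota 0 k)) = map va (iota (unrolled k.-1).+1 n).
Proof. by rewrite flatten_segments addnC unrolledDk addKn. Qed.

(** In the original order the joins are exactly the removed edges, so the edges inside the segments
    are the ones that a move keeps. *)
Lemma links_segments : cycle_pairs link (map segment (iota 0 k)) = removed k n T p.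
Proof.
rewrite cycle_pairs_iota; last by rewrite add0n segment_k.
apply/eq_in_map => i; rewrite mem_iota add0n => /andP[_ lt].
rewrite /link last_segment head_segment.
have -> : i.+1 + k.-1 = i + k by lia.
by rewrite modnDr !modn_small.
Qed.

Lemma last_orient x : x.1 < k -> last 0 (orient x.2 (segment x.1)) = vx (slot_last k x).
Proof.
case: x => i [] /= lt; last by rewrite last_segment modn_small.
by rewrite /slot_last /= -head_segment; case: (segment i) => //= a s; rewrite rev_cons last_rcons.
Qed.

Lemma head_orient x : x.1 < k -> head 0 (orient x.2 (segment x.1)) = vx (slot_head k x).
Proof.
case: x => i [] /= lt; last by rewrite head_segment.
rewrite /slot_head /slot_last /= -{2}(modn_small lt) -last_segment.
by case/lastP: (segment i) => // s a; rewrite rev_rcons last_rcons.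
Qed.

Lemma links_arrange w : is_word k w ->
  cycle_pairs link (arrange segment w) = added n T p (signature k w).
Proof.
move=> ww; have {ww} : all (fun x => x.1 < k) w.
  apply/allP => x xw; have := map_f fst xw.
  by rewrite (perm_mem ww) mem_iota.
case: w => // x w /andP[xk wk].
rewrite /cycle_pairs /arrange /signature /added /= -map_rcons.
have {wk} : all (fun x => x.1 < k) (rcons w x) by rewrite all_rcons xk.
move: (rcons w x) => s; elim: s x xk => //= y s ih x xk /andP[yk sk].
by rewrite ih // /link last_orient // head_orient.
Qed.

Lemma path_edges_segments :
  perm_eq (tour_edges n T)
    (flatten (map path_edges (map segment (iota 0 k))) ++ removed k n T p).
Proof.
rewrite -links_segments perm_sym; apply: perm_trans _ (tour_edges_rotate n T (unrolled k.-1).+1).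
rewrite perm_sym -flatten_segmentsk; apply: cycle_edges_flatten.
by apply/allP => s /mapP[i _ ->]; apply: segment_nil.
Qed.

(** The edges of a tour are distinct, so its splitting into inner and removed edges is disjoint and
    the filter returns the first part. *)
Lemma kept_edges X : perm_eq X (removed k n T p) ->
  perm_eq [seq e <- tour_edges n T | e \notin X]
          (flatten (map path_edges (map segment (iota 0 k)))).
Proof.
move=> pX; have := tour_edges_uniq tourT.
rewrite (perm_uniq path_edges_segments) cat_uniq => /and3P[_ /hasPn disj _].
apply: perm_trans (perm_filter _ path_edges_segments) _; rewrite filter_cat.
rewrite (@eq_in_filter _ _ predT) ?filter_predT; last first.
  by move=> e he; rewrite (perm_mem pX) /=; apply/negP => /disj; rewrite he.
rewrite (@eq_in_filter _ _ pred0) ?filter_pred0 ?cats0 // => e he.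
by rewrite (perm_mem pX) he.
Qed.

Lemma removed_uniq : uniq (removed k n T p).
Proof.
have := tour_edges_uniq tourT; rewrite (perm_uniq path_edges_segments) cat_uniq.
by case/and3P.
Qed.

(** The segments glued along [w] form the new tour. Distinctness and validity of the added edges are
    inherited from its edge list. *)
Lemma word_is_kmove w : is_word k w ->
  is_kmove k n T (removed k n T p) (added n T p (signature k w)).
Proof.
move=> ww; pose T' := flatten (arrange segment w).
have pT : perm_eq T' (map va (iota (unrolled k.-1).+1 n)).
  by rewrite -flatten_segmentsk; apply: perm_arrange.
have tourT' : is_tour n T'.
  split; first exact: tour_gt2 tourT.
  apply: perm_trans pT _; apply: perm_trans (tour_rotate tourT _) _.
  by case: tourT.
have pE : perm_eq (tour_edges n T')
    ([seq e <- tour_edges n T | e \notin removed k n T p] ++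
     added n T p (signature k w)).
  rewrite perm_sym; apply: perm_trans _ (tour_edges_rotate n T' 0).
  rewrite (tour_iota tourT').
  rewrite perm_sym; apply: perm_trans (cycle_edges_flatten _) _.
    by apply/allP => s /mapP[x _ ->]; rewrite orient_nil segment_nil.
  rewrite links_arrange // perm_cat2r.
  apply: perm_trans (path_edges_arrange _ ww) _.
  by rewrite perm_sym kept_edges.
have subY : {subset added n T p (signature k w) <= tour_edges n T'}.
  by move=> e he; rewrite (perm_mem pE) mem_cat he orbT.
split.
- split; [exact: removed_uniq|by rewrite size_map size_iota|].
  by move=> e he; rewrite (perm_mem path_edges_segments) mem_cat he orbT.
- split.
  + have := tour_edges_uniq tourT'; rewrite (perm_uniq pE) cat_uniq; by case/and3P.
  + have := perm_size ww; rewrite size_map size_iota => <-; rewrite size_map.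
    by case: (w) => // x w' /=; rewrite size_pairmap size_rcons.
  + by apply/allP => e /subY; apply: (allP (tour_edges_edge tourT')).
- by exists T'.
Qed.

End Segments.

(** The positions of the removed edges, in increasing order, give p; the word is read off the new
    tour. *)
Lemma kmove_is_word k n T X Y : is_tour n T -> 0 < k -> is_kmove k n T X Y ->
  exists p w, [/\ increasing k p, forall i, i < k -> p i < n, is_word k w &
    perm_eq X (removed k n T p) /\ perm_eq Y (added n T p (signature k w))].
Proof.
move=> tourT k0 [[uX sX subX] [uY sY eY] [T' [tourT' pE]]].
have n2 := tour_gt2 tourT.
pose g x := edge (vat n T x) (vat n T x.+1).
pose ps := [seq x <- iota 0 n | g x \in X].
have pX : perm_eq X (map g ps).
  have -> : map g ps = [seq e <- tour_edges n T | e \in X].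
    by rewrite tour_edgesE filter_map.
  apply: uniq_perm => //; first by rewrite filter_uniq // tour_edges_uniq.
  move=> e; rewrite mem_filter; case eX : (e \in X) => //=.
  by rewrite subX.
have sps : size ps = k by rewrite -sX (perm_size pX) size_map.
have sorted_ps : sorted ltn ps.
  by apply: sorted_filter; [exact: ltn_trans|exact: iota_ltn_sorted].
pose p i := nth 0 ps i.
have incp : increasing k p.
  move=> i j ij jk; apply: (sorted_ltn_nth ltn_trans) => //;
  rewrite inE sps //; exact: ltn_trans jk.
have ltp i : i < k -> p i < n.
  move=> ik; have : p i \in ps by rewrite mem_nth // sps.
  by rewrite mem_filter mem_iota => /and3P[].
have eR : map g ps = removed k n T p.
  apply: (@eq_from_nth _ (0, 0)); first by rewrite !size_map size_iota.
  move=> i; rewrite size_map sps => ik.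
  rewrite (nth_map 0) ?sps // (nth_map 0) ?size_iota // nth_iota //.
  by rewrite /g /vtx /= addn0 addn1.
rewrite eR in pX.
have kept := kept_edges tourT k0 incp ltp pX.
set L := segment n T k p in kept.
have pE' : perm_eq (tour_edges n T') (flatten (map path_edges (map L (iota 0 k))) ++ Y).
  by apply: perm_trans pE _; rewrite perm_cat2r.
(* Opening T' at an added edge y yields a path [s]. It still contains every kept edge, as y is not
   one of them, so [arrange_of_path] applies. *)
have [y yY] : exists y, y \in Y.
  by case: (Y) sY k0 => [<- //|y Y' _ _]; exists y; rewrite mem_head.
have : y \in tour_edges n T' by rewrite (perm_mem pE') mem_cat yY orbT.
rewrite tour_edgesE => /mapP[j]; rewrite mem_iota => /andP[_ jn] ey.
pose s := map (vat n T') (iota j.+1 n).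
have us : uniq s by rewrite (perm_uniq (tour_rotate tourT' _)) (tour_uniq tourT').
have ns : s != [::] by rewrite -size_eq0 size_map size_iota; lia.
have ps' : perm_eq (rcons (path_edges s) y)
                   (flatten (map path_edges (map L (iota 0 k))) ++ Y).
  apply: perm_trans _ pE'; apply: perm_trans _ (tour_edges_rotate n T' j.+1).
  rewrite cycle_edges_rcons //; suff -> : link s s = y by [].
  rewrite ey /link /s; case: (n) n2 (@vatDn n T') => // n' _ per.
  rewrite {1}iotaSr map_rcons last_rcons /=.
  by rewrite addSnnS per.
have disj e : e \in flatten (map path_edges (map L (iota 0 k))) -> e \in path_edges s.
  move=> he; have : e \in rcons (path_edges s) y.
    by rewrite (perm_mem ps') mem_cat he.
  rewrite mem_rcons inE => /orP[/eqP e_y|//].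
  have := tour_edges_uniq tourT'; rewrite (perm_uniq pE') cat_uniq.
  by move=> /and3P[_ /hasPn/(_ y yY)]; rewrite -e_y he.
have [|||||w ww ew] := @arrange_of_path L (iota 0 k) s.
- exact: iota_uniq.
- exact: us.
- by move=> i _; apply: segment_nil.
- rewrite (flatten_segmentsk T k0 incp ltp).
  apply: perm_trans (tour_rotate tourT' _) _; rewrite perm_sym.
  apply: perm_trans (tour_rotate tourT _) _.
  by case: tourT => _ /perm_trans; apply; rewrite perm_sym; case: tourT'.
- move=> i iI e he; apply: disj; apply/flattenP.
  by exists (path_edges (L i)) => //; do 2!apply: map_f.
exists p, w; split => //; split => //.
(* The edges of T' are the inner edges together with Y, but also the inner edges together with the
   joins of the arrangement; cancelling the inner edges identifies Y. *)
rewrite -(links_arrange T k0 incp ltp ww).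
rewrite -(perm_cat2l (flatten (map path_edges (map L (iota 0 k))))).
rewrite -(permPl pE') perm_sym.
apply: perm_trans _ (tour_edges_rotate n T' j.+1); rewrite perm_sym -/s ew.
apply: perm_trans (cycle_edges_flatten _) _.
  by apply/allP => t /mapP[x _ ->]; rewrite orient_nil segment_nil.
by rewrite perm_cat2r path_edges_arrange.
Qed.

(** * Splitting the cost over an independent set *)

HB.instance Definition _ :=
  Monoid.isComLaw.Build Z 0%Z Z.add Z.add_assoc Z.add_comm Z.add_0_l.

Notation "\zsum_ ( i <- r ) F" := (\big[Z.add/0%Z]_(i <- r) F%Z)
  (at level 41, F at level 41, i, r at level 50).

Lemma zsum_sub (A : Type) (s : seq A) (F G : A -> Z) :
  (\zsum_(x <- s) (F x - G x) = (\zsum_(x <- s) F x) - \zsum_(x <- s) G x)%Z.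
Proof. elim: s => [|x s ih]; rewrite ?big_nil ?big_cons // ih; lia. Qed.

Definition slot_cost (d : nat -> nat -> Z) n T p (x : slot * slot) : Z :=
  d (vtx n T p x.1) (vtx n T p x.2).

Definition move_cost (d : nat -> nat -> Z) k n T (sg : seq (slot * slot)) p : Z :=
  ((\zsum_(x <- sg) slot_cost d n T p x) -
   \zsum_(i <- iota 0 k) slot_cost d n T p ((i, false), (i, true)))%Z.

Lemma wsumE d E : wsum d E = \zsum_(e <- E) d e.1 e.2.
Proof. by elim: E => [|e E ih]; rewrite ?big_nil ?big_cons //= ih. Qed.

Lemma delta_perm d X X' Y Y' :
  perm_eq X X' -> perm_eq Y Y' -> delta d X Y = delta d X' Y'.
Proof.
by move=> pX pY; rewrite /delta !wsumE (perm_big _ pX) (perm_big _ pY).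
Qed.

Lemma delta_move_cost d k n T sg p : is_tour n T ->
  (forall i j, i < n -> j < n -> d i j = d j i) ->
  delta d (removed k n T p) (added n T p sg) = move_cost d k n T sg p.
Proof.
move=> tourT symd.
have sym a b : d (edge (vtx n T p a) (vtx n T p b)).1
                 (edge (vtx n T p a) (vtx n T p b)).2 =
               d (vtx n T p a) (vtx n T p b).
  have la := vat_lt tourT (p a.1 + a.2); have lb := vat_lt tourT (p b.1 + b.2).
  rewrite /edge /minn /maxn; case: ltnP => //= _; exact: symd.
rewrite /delta /move_cost !wsumE !big_map.
by congr (_ - _)%Z; apply: eq_bigr => x _; rewrite sym.
Qed.

(* Charge every pair to a free index if it has one. *)
Definition owner (U : seq nat) (x : slot * slot) : nat :=
  if x.1.1 \in U then x.1.1 else x.2.1.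

Definition owned (sg : seq (slot * slot)) U j := [seq x <- sg | owner U x == j].

Definition local_cost d n T sg U j p : Z :=
  ((\zsum_(x <- owned sg U j) slot_cost d n T p x) -
   slot_cost d n T p ((j, false), (j, true)))%Z.

(** A pair may have both ends at the same free index, as when a degenerate move reinserts a removed
    edge; its cost is still a function of that one position. *)
Definition independent (sg : seq (slot * slot)) (U : seq nat) : Prop :=
  forall x, x \in sg -> x.1.1 \in U -> x.2.1 \in U -> x.1.1 = x.2.1.

Lemma owned_indices sg U j x : independent sg U -> x \in owned sg U j ->
  (x.1.1 = j \/ x.1.1 \notin U) /\ (x.2.1 = j \/ x.2.1 \notin U).
Proof.
move=> ind; rewrite mem_filter /owner => /andP[+ xs].
case: ifP => [x1 /eqP e|x1 /eqP e]; last by split; [right|left].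
split; first by left.
case x2 : (x.2.1 \in U); last by right.
by left; rewrite -(ind x).
Qed.

(** The separability behind the sweep: once the positions outside [U] are fixed, the j-th term
    depends on p_j only. *)
Lemma local_cost_ext d n T sg U j p q : independent sg U ->
  (forall x i, x \in sg -> (i = x.1.1 \/ i = x.2.1) -> i \notin U -> p i = q i) ->
  p j = q j -> local_cost d n T sg U j p = local_cost d n T sg U j q.
Proof.
move=> ind pq pj; rewrite /local_cost /slot_cost /vtx /= pj; congr (_ - _)%Z.
rewrite big_seq [RHS]big_seq; apply: eq_bigr => x xo.
have [i1 i2] := owned_indices ind xo.
have xs : x \in sg by move: xo; rewrite mem_filter => /andP[].
have -> : p x.1.1 = q x.1.1.
  by case: i1 => [->//|h]; apply: pq xs _ h; left.
have -> // : p x.2.1 = q x.2.1.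
by case: i2 => [->//|h]; apply: pq xs _ h; right.
Qed.

(** Every pair has exactly one owner, so exchanging the sums counts it once. *)
Lemma move_cost_local d k n T sg U p :
  (forall x, x \in sg -> x.1.1 < k /\ x.2.1 < k) ->
  move_cost d k n T sg p = \zsum_(j <- iota 0 k) local_cost d n T sg U j p.
Proof.
move=> lt; rewrite /move_cost /local_cost zsum_sub; congr (_ - _)%Z.
under [RHS]eq_bigr => j _ do rewrite big_filter big_mkcond.
rewrite exchange_big /= big_seq [RHS]big_seq; apply: eq_bigr => x xs.
rewrite -big_mkcond (eq_bigl (pred1 (owner U x))); last by move=> j; rewrite /= eq_sym.
rewrite -big_filter filter_pred1_uniq ?iota_uniq ?big_seq1 //.
by rewrite mem_iota /owner; case: (lt x xs); case: ifP.
Qed.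

(** * The conflict graph of a word has degree at most two *)

Section Independence.

Variables (k : nat) (w : seq (nat * bool)).
Hypotheses (k0 : 0 < k) (ww : is_word k w).

Local Notation sg := (signature k w).

Definition neighbors (j : nat) : seq nat :=
  [seq x.2.1 | x <- sg & x.1.1 == j] ++ [seq x.1.1 | x <- sg & x.2.1 == j].

Lemma signature_fst : map fst sg = map (slot_last k) w.
Proof.
rewrite /signature; case: (w) => // x s /=; elim: s {1 3}x => //= y s ih z.
by rewrite ih.
Qed.

Lemma signature_snd : perm_eq (map snd sg) (map (slot_head k) w).
Proof.
rewrite /signature; case: (w) => // x s.
have -> : map snd (cycle_pairs (fun x y => (slot_last k x, slot_head k y)) (x :: s)) =
    map (slot_head k) (rcons s x).
  by rewrite /cycle_pairs; elim: (rcons s x) {1}x => //= z t ih y; rewrite ih.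
by rewrite map_rcons perm_rcons.
Qed.

(** Reversing a segment i only swaps its two ends, which carry the indices i and i - 1 in either
    case. So j is met once as i and once as i - 1, whatever the orientations. *)
Lemma slot_index_count j :
  count (fun x => (slot_last k x).1 == j) w +
  count (fun x => (slot_head k x).1 == j) w <= 2.
Proof.
have -> : count (fun x => (slot_last k x).1 == j) w +
          count (fun x => (slot_head k x).1 == j) w =
    count (pred1 j) (map fst w) +
    count (fun i => (i + k.-1) %% k == j) (map fst w).
  rewrite !count_map.
  elim: (w) => //= -[i b] s ih.
  rewrite addnACA ih [RHS]addnACA; congr (_ + _).
  by case: b => //=; rewrite addnC.
have h0 := permP ww; rewrite !h0.
apply: (@leq_add _ _ 1 1).
  by rewrite count_uniq_mem ?iota_uniq //; case: (_ \in _).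
rewrite -(count_map (fun i => (i + k.-1) %% k) (pred1 j)).
rewrite count_uniq_mem; first by case: (_ \in _).
rewrite map_inj_in_uniq ?iota_uniq // => x y; rewrite !mem_iota !add0n /= => lx ly.
by move=> /eqP; rewrite eqn_modDr !modn_small // => /eqP.
Qed.

Lemma size_neighbors j : size (neighbors j) <= 2.
Proof.
rewrite size_cat !size_map !size_filter.
have -> : count (fun x : slot * slot => x.1.1 == j) sg =
          count (fun x => (slot_last k x).1 == j) w.
  rewrite -(count_map fst (fun a : slot => a.1 == j)) signature_fst.
  by rewrite count_map; apply: eq_count.
have -> : count (fun x : slot * slot => x.2.1 == j) sg =
          count (fun x => (slot_head k x).1 == j) w.
  rewrite -(count_map snd (fun a : slot => a.1 == j)) (permP signature_snd).
  by rewrite count_map; apply: eq_count.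
exact: slot_index_count.
Qed.

Lemma slot_last_lt x : x.1 < k -> (slot_last k x).1 < k.
Proof. by rewrite /slot_last; case: x.2 => //=; rewrite ltn_mod. Qed.

Lemma word_lt x : x \in w -> x.1 < k.
Proof. by move=> /(map_f fst); rewrite (perm_mem ww) mem_iota. Qed.

Lemma signature_lt x : x \in sg -> x.1.1 < k /\ x.2.1 < k.
Proof.
move=> xs; split.
  have := map_f fst xs; rewrite signature_fst => /mapP[y yw ->].
  by apply: slot_last_lt; apply: word_lt.
have := map_f snd xs; rewrite (perm_mem signature_snd) => /mapP[y yw ->].
by apply: slot_last_lt => /=; apply: word_lt.
Qed.

(** Each chosen index discards itself and at most two neighbours, whence the factor 3. *)
Lemma greedy_independent (V : seq nat) : uniq V ->
  exists U : seq nat, [/\ {subset U <= V}, uniq U, size V <= 3 * size U & independent sg U].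
Proof.
elim: {V}(size V) {-2}V (leqnn (size V)) => [|N ih] [|v V] //=.
- by move=> _ _; exists [::]; split.
- by move=> _ _; exists [::]; split.
rewrite ltnS => sV /andP[vV uV].
pose V' := [seq x <- V | x \notin neighbors v].
have sV' : size V' <= N by rewrite (leq_trans _ sV) // size_filter count_size.
have [U [subU uU sU indU]] := ih V' sV' (filter_uniq _ uV).
have nU x : x \in U -> (x \in V) && (x \notin neighbors v).
  by move=> /subU; rewrite mem_filter andbC.
exists (v :: U); split.
- by move=> x; rewrite !inE => /orP[->//|/nU/andP[-> _]]; rewrite orbT.
- by rewrite /= uU andbT; apply: contra vV => /nU/andP[].
- have : size V <= size V' + 2.
    rewrite -(count_predC (fun x => x \notin neighbors v) V) -!size_filter leq_add2l.
    apply: leq_trans (size_neighbors v).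
    apply: uniq_leq_size; first exact: filter_uniq.
    by move=> x; rewrite mem_filter /= negbK => /andP[].
  by move: sU; rewrite /=; lia.
- move=> x xs; rewrite !inE => /orP[/eqP e1|x1] /orP[/eqP e2|x2].
  + by rewrite e1 e2.
  + have /andP[_ /negP[]] := nU _ x2; rewrite mem_cat; apply/orP; left.
    by apply/mapP; exists x => //; rewrite mem_filter e1 eqxx.
  + have /andP[_ /negP[]] := nU _ x1; rewrite mem_cat; apply/orP; right.
    by apply/mapP; exists x => //; rewrite mem_filter e2 eqxx.
  + exact: indU.
Qed.

End Independence.

(** * Evaluating the cost in registers *)

Local Opaque rd wrt.

Definition cseq (cs : seq cmd) : cmd := foldr CSeq CSkip cs.

Lemma writes_in_cseq p cs : writes_in p (cseq cs) = all (writes_in p) cs.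
Proof. by elim: cs => //= c cs ->. Qed.

Lemma nostore_cseq cs : nostore (cseq cs) = all nostore cs.
Proof. by elim: cs => //= c cs ->. Qed.

Fixpoint basic (c : cmd) : bool :=
  match c with
  | CStore _ _ | CFor _ _ => false
  | CSeq c1 c2 | CIf _ _ c1 c2 => basic c1 && basic c2
  | _ => true
  end.

Lemma basic_cseq cs : basic (cseq cs) = all basic cs.
Proof. by elim: cs => //= c cs ->. Qed.

Lemma basicP c : basic c -> [/\ nostore c, wf c & depth c = 0].
Proof.
elim: c => //= [c1 h1 c2 h2|a b c1 h1 c2 h2] /andP[/h1[-> -> ->] /h2[-> -> ->]];
by split.
Qed.

Lemma basic_nostore c : basic c -> nostore c.
Proof. by case/basicP. Qed.

Lemma wf_cseq cs : wf (cseq cs) = all wf cs.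
Proof. by elim: cs => //= c cs ->. Qed.

Lemma depth_cseq cs b : all (fun c => depth c <= b) cs -> depth (cseq cs) <= b.
Proof. by elim: cs => //= c cs ih /andP[h1 h2]; rewrite geq_max h1 ih. Qed.

(** The first component is the class of a register, which settles most disjointness questions by
    computation. [rflag j] tells whether level j of the sweep holds a choice, [rval j] is its cost
    and [rarg j i] its i-th position. *)
Definition rbase : reg := (1, 0, 0).
Definition rtmp : reg := (1, 1, 0).
Definition rtmp2 : reg := (1, 2, 0).
Definition racc : reg := (1, 3, 0).
Definition rq : reg := (1, 4, 0).
Definition rbest : reg := (1, 5, 0).
Definition rpos (i : nat) : reg := (2, i, 0).
Definition rflag (j : nat) : reg := (3, j, 0).
Definition rval (j : nat) : reg := (4, j, 0).
Definition rarg (j i : nat) : reg := (5, j, i).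
Definition rout (t s : nat) : reg := (6, t, s).

(** The length of the input, hence the first free cell. *)
Definition base (n : nat) : nat := n + 1 + n * n.

(* The input, followed by a table of the addresses n+1+u*n of the rows of the
   distance matrix: the machine cannot multiply. *)
Definition heap_ok (n : nat) (T : seq nat) (d : nat -> nat -> Z) (m : memory) : Prop :=
  [/\ consts_ok n m, rd m rbase = Z.of_nat (base n),
      forall i, i < n -> m (Z.of_nat i + 1)%Z = Z.of_nat (nth 0 T i),
      forall u v, u < n -> v < n -> m (Z.of_nat (n + 1 + u * n + v)) = d u v &
      forall u, u < n -> m (Z.of_nat (base n + u)) = Z.of_nat (n + 1 + u * n)].

Definition working : pred reg := fun r => nonconst r && (r != rbase).

Lemma heap_ok_exec n T d c m : nostore c -> writes_in working c ->
  heap_ok n T d m -> heap_ok n T d (exec n c m).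
Proof.
move=> ns w [h1 h2 h3 h4 h5]; split.
- by apply: exec_consts h1; apply: writes_in_sub w => r /andP[].
- by rewrite (exec_frame _ _ w).
- by move=> i lt; rewrite exec_heap ?h3 //; lia.
- by move=> u v lu lv; rewrite exec_heap ?h4 //; lia.
- by move=> u lu; rewrite exec_heap ?h5 //; lia.
Qed.

(** Cell x + 1 holds T[x], so adding [rone] yields the address of T[x]. It is also the number x + 1,
    which for the successor is reduced modulo n by one test before the second increment. *)
Definition fetch (r src : reg) (b : bool) : cmd :=
  cseq [:: CAdd r src rone;
           if b then cseq [:: CIf r rsize CSkip (CConst r 0); CAdd r r rone] else CSkip;
           CLoad r r].

Lemma writes_fetch p r src b : writes_in p (fetch r src b) = p r.
Proof. by rewrite /fetch; case: b => /=; rewrite ?andbT ?andbb. Qed.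

Lemma basic_fetch r src b : basic (fetch r src b).
Proof. by case: b. Qed.

Lemma fetchE n T d m r src b x : heap_ok n T d m -> nonconst r ->
  rd m src = Z.of_nat x -> x < n ->
  rd (exec n (fetch r src b) m) r = Z.of_nat (vat n T (x + b)).
Proof.
move=> [[h1 h0 hn] _ hT _ _] nr hx lt.
have o1 : (rone == r) = false by apply: contraTF nr => /eqP<-.
have o3 : (rsize == r) = false by apply: contraTF nr => /eqP<-.
have load v m' : rd m' r = (Z.of_nat v + 1)%Z -> v < n ->
   (forall a, (0 <= a)%Z -> m' a = m a) ->
   rd (wrt m' r (m' (rd m' r))) r = Z.of_nat (nth 0 T v).
  move=> e lv hm; rewrite rd_wrt eqxx e hm ?hT //; lia.
have n0 : 0 < n by lia.
rewrite /fetch /vat; case: b => /=; apply: load; rewrite ?ltn_mod //.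
- rewrite !rd_wrt eqxx o3 hx h1 hn.
  case: Z.ltb_spec => hlt; rewrite !rd_wrt eqxx o1 ?hx h1.
    rewrite modn_small; lia.
  by rewrite (_ : x + 1 = n) ?modnn //; lia.
- by move=> a ha; case: ifP => _; rewrite !wrt_heap.
- by rewrite rd_wrt eqxx hx h1 addn0 modn_small.
- by move=> a ha; rewrite wrt_heap.
Qed.

Local Opaque fetch.

Definition slot_cmd (x : slot * slot) : cmd :=
  cseq [:: fetch rtmp (rpos x.1.1) x.1.2; CAdd rtmp rtmp rbase; CLoad rtmp rtmp;
           fetch rtmp2 (rpos x.2.1) x.2.2; CAdd rtmp rtmp rtmp2; CLoad rtmp rtmp].

Lemma writes_slot_cmd p x : writes_in p (slot_cmd x) = p rtmp && p rtmp2.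
Proof.
rewrite /slot_cmd writes_in_cseq /= !writes_fetch /=.
by case: (p rtmp); case: (p rtmp2).
Qed.

Lemma basic_slot_cmd x : basic (slot_cmd x).
Proof. by rewrite /slot_cmd basic_cseq /= !basic_fetch. Qed.

Lemma slot_cmdE n T d m x p : is_tour n T -> heap_ok n T d m ->
  rd m (rpos x.1.1) = Z.of_nat (p x.1.1) -> p x.1.1 < n ->
  rd m (rpos x.2.1) = Z.of_nat (p x.2.1) -> p x.2.1 < n ->
  rd (exec n (slot_cmd x) m) rtmp = slot_cost d n T p x.
Proof.
move=> tourT hm e1 l1 e2 l2.
set c1 := fetch rtmp (rpos x.1.1) x.1.2.
set c2 := fetch rtmp2 (rpos x.2.1) x.2.2.
have u1 := vat_lt tourT (p x.1.1 + x.1.2); have u2 := vat_lt tourT (p x.2.1 + x.2.2).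
rewrite /slot_cmd /= -/c1 -/c2.
set m1 := exec n c1 m.
have hm1 : heap_ok n T d m1.
  by apply: heap_ok_exec => //; [apply/basic_nostore/basic_fetch|rewrite writes_fetch].
have f1 : rd m1 rtmp = Z.of_nat (vtx n T p x.1).
  exact: (@fetchE _ _ _ _ rtmp _ _ _ hm isT e1 l1).
have {}e2 : rd m1 (rpos x.2.1) = Z.of_nat (p x.2.1).
  by rewrite (@exec_frame n (pred1 rtmp)) ?writes_fetch.
clearbody m1.
set m2 := wrt (wrt m1 _ _) _ _.
have f2 : rd m2 rtmp = Z.of_nat (n + 1 + vtx n T p x.1 * n).
  rewrite /m2 !rd_wrt eqxx f1; case: hm1 => _ -> _ _ hrow.
  rewrite wrt_heap; last by apply: Z.add_nonneg_nonneg; apply: Nat2Z.is_nonneg.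
  by rewrite Z.add_comm -Nat2Z.inj_add hrow.
have hm2 : heap_ok n T d m2.
  by apply: (@heap_ok_exec _ _ _ (CLoad _ _)) => //; apply: (@heap_ok_exec _ _ _ (CAdd _ _ _)).
have {}e2 : rd m2 (rpos x.2.1) = Z.of_nat (p x.2.1) by rewrite /m2 !rd_wrt.
clearbody m2.
set m3 := exec n c2 m2.
have [_ _ _ hd _] : heap_ok n T d m3.
  by apply: heap_ok_exec => //; [apply/basic_nostore/basic_fetch|rewrite writes_fetch].
have f3 : rd m3 rtmp2 = Z.of_nat (vtx n T p x.2).
  exact: (@fetchE _ _ _ _ rtmp2 _ _ _ hm2 isT e2 l2).
have f3' : rd m3 rtmp = rd m2 rtmp.
  by rewrite (@exec_frame n (pred1 rtmp2)) ?writes_fetch.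
clearbody m3.
rewrite !rd_wrt eqxx f3' f2 f3 wrt_heap; last first.
  by apply: Z.add_nonneg_nonneg; apply: Nat2Z.is_nonneg.
by rewrite -Nat2Z.inj_add; apply: hd.
Qed.

Local Opaque slot_cmd.

Definition sum_cmd (xs : seq (slot * slot)) : cmd :=
  cseq [seq CSeq (slot_cmd x) (CAdd racc racc rtmp) | x <- xs].

Definition scratch : pred reg := fun r => r \in [:: rtmp; rtmp2; racc].

Lemma scratch_working : subpred scratch working.
Proof. by move=> r; rewrite /scratch !inE => /or3P[]/eqP->. Qed.

Lemma writes_sum_cmd xs : writes_in scratch (sum_cmd xs).
Proof.
rewrite writes_in_cseq all_map; apply/allP => x _ /=.
by rewrite writes_slot_cmd.
Qed.

Lemma basic_sum_cmd xs : basic (sum_cmd xs).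
Proof.
rewrite basic_cseq all_map; apply/allP => x _ /=.
by rewrite basic_slot_cmd.
Qed.

Lemma sum_cmdE n T d m xs p : is_tour n T -> heap_ok n T d m ->
  (forall x i, x \in xs -> i = x.1.1 \/ i = x.2.1 ->
     rd m (rpos i) = Z.of_nat (p i) /\ p i < n) ->
  rd (exec n (sum_cmd xs) m) racc =
  (rd m racc + \zsum_(x <- xs) slot_cost d n T p x)%Z.
Proof.
move=> tourT; elim: xs m => [|x xs ih] m hm hp; first by rewrite big_nil Z.add_0_r.
rewrite /sum_cmd /= big_cons -/(sum_cmd xs).
have [e1 l1] := hp x x.1.1 (mem_head _ _) (or_introl erefl).
have [e2 l2] := hp x x.2.1 (mem_head _ _) (or_intror erefl).
have sc := slot_cmdE tourT hm e1 l1 e2 l2.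
have ws : writes_in (pred2 rtmp rtmp2) (slot_cmd x) by rewrite writes_slot_cmd.
rewrite ih.
- by rewrite rd_wrt eqxx sc (exec_frame _ _ ws) // Z.add_assoc.
- apply: (@heap_ok_exec _ _ _ (CAdd _ _ _)) => //; apply: heap_ok_exec => //.
    exact/basic_nostore/basic_slot_cmd.
  by rewrite writes_slot_cmd.
- move=> y i yx hi; rewrite rd_wrt /= (exec_frame _ _ ws) //.
  by apply: (hp y) => //; rewrite inE yx orbT.
Qed.

Local Opaque sum_cmd.

(** Accumulation starts from the value of level j, so the result is directly the candidate for level
    j + 1. *)
Definition local_cmd sg U j : cmd :=
  cseq [:: CAdd racc (rval j) rzero; sum_cmd (owned sg U j);
           slot_cmd ((j, false), (j, true)); CSub racc racc rtmp].

Lemma writes_local_cmd sg U j : writes_in scratch (local_cmd sg U j).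
Proof. by rewrite writes_in_cseq /= writes_sum_cmd writes_slot_cmd. Qed.

Lemma basic_local_cmd sg U j : basic (local_cmd sg U j).
Proof. by rewrite basic_cseq /= basic_sum_cmd basic_slot_cmd. Qed.

Lemma local_cmdE n T d m sg U j p : is_tour n T -> heap_ok n T d m ->
  independent sg U -> rd m (rpos j) = Z.of_nat (p j) -> p j < n ->
  (forall x i, x \in sg -> (i = x.1.1 \/ i = x.2.1) -> i \notin U ->
     rd m (rpos i) = Z.of_nat (p i) /\ p i < n) ->
  rd (exec n (local_cmd sg U j) m) racc =
  (rd m (rval j) + local_cost d n T sg U j p)%Z.
Proof.
move=> tourT hm ind ej lj hp.
have hx x i : x \in owned sg U j -> i = x.1.1 \/ i = x.2.1 ->
     rd m (rpos i) = Z.of_nat (p i) /\ p i < n.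
  move=> xo hi; have [i1 i2] := owned_indices ind xo.
  have xs : x \in sg by move: xo; rewrite mem_filter => /andP[].
  case: hi => hi; [case: i1|case: i2]; rewrite -hi => h; rewrite ?h //.
    by apply: hp xs _ h; left.
  by apply: hp xs _ h; right.
pose m1 := exec n (CAdd racc (rval j) rzero) m.
have hm1 : heap_ok n T d m1 by apply: heap_ok_exec.
have e1 : rd m1 racc = rd m (rval j).
  by rewrite /m1 /= rd_wrt eqxx; case: hm => -[_ -> _] _ _ _ _; lia.
have r1 i : rd m1 (rpos i) = rd m (rpos i) by rewrite /m1 /= rd_wrt.
pose m2 := exec n (sum_cmd (owned sg U j)) m1.
have hm2 : heap_ok n T d m2.
  apply: heap_ok_exec => //; first exact/basic_nostore/basic_sum_cmd.
  exact: writes_in_sub scratch_working (writes_sum_cmd _).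
have e2 : rd m2 racc = (rd m (rval j) + \zsum_(x <- owned sg U j) slot_cost d n T p x)%Z.
  rewrite -e1; apply: sum_cmdE => // x i xo hi; rewrite r1; exact: (hx x).
have r2 i : rd m2 (rpos i) = rd m (rpos i).
  by rewrite (exec_frame _ _ (writes_sum_cmd _)) ?r1.
set x := ((j, false), (j, true)).
have e3 : rd (exec n (slot_cmd x) m2) rtmp = slot_cost d n T p x.
  by apply: slot_cmdE => //=; rewrite r2.
rewrite /local_cmd /= -/x -/m1 -/m2 rd_wrt eqxx e3.
rewrite (@exec_frame n (pred2 rtmp rtmp2)) ?writes_slot_cmd // e2 /local_cost.
rewrite -/x; lia.
Qed.

Local Opaque local_cmd.

(** * The sweep *)

Definition copy_cmd (j : nat) (s : seq nat) : cmd :=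
  cseq [seq CAdd (rarg j.+1 i) (rarg j i) rzero | i <- s].

Definition record_cmd (j : nat) : cmd :=
  cseq [:: CAdd (rval j.+1) racc rzero; CConst (rflag j.+1) 1;
           copy_cmd j (iota 0 j); CAdd (rarg j.+1 j) rq rzero].

Definition level_regs (j : nat) : pred reg :=
  fun r => [|| r == rflag j, r == rval j | (r.1.1 == 5) && (r.1.2 == j)].

Lemma writes_copy_cmd j s :
  writes_in (fun r => [&& r.1.1 == 5, r.1.2 == j.+1 & r.2 \in s]) (copy_cmd j s).
Proof. by rewrite writes_in_cseq all_map; apply/allP => i si /=; rewrite eqxx. Qed.

Lemma writes_record_cmd j : writes_in (level_regs j.+1) (record_cmd j).
Proof.
rewrite writes_in_cseq [all _ _]/=; apply/and5P; split=> //.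
- by rewrite /level_regs eqxx orbT.
- by rewrite /level_regs eqxx.
- apply: writes_in_sub (writes_copy_cmd _ _) => r /and3P[h1 h2 _].
  by rewrite /level_regs h1 h2 !orbT.
- by rewrite /level_regs /= eqxx ?orbT.
Qed.

Lemma basic_record_cmd j : basic (record_cmd j).
Proof. by rewrite basic_cseq /= basic_cseq all_map andbT; apply/allP. Qed.

Lemma copy_cmdE n j s m i : rd m rzero = 0%Z -> i \in s ->
  rd (exec n (copy_cmd j s) m) (rarg j.+1 i) = rd m (rarg j i).
Proof.
elim: s m => // a s ih m z is_.
rewrite /copy_cmd /= -/(copy_cmd j s).
have e : (rarg j i == rarg j.+1 a) = false.
  by apply/eqP => -[] /eqP; rewrite eqn_leq ltnn andbF.
case his : (i \in s); first by rewrite ih // rd_wrt ?e.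
move: is_; rewrite inE his orbF => /eqP ei; rewrite -{a}ei in e *.
rewrite (exec_frame _ _ (writes_copy_cmd _ _)) /= ?his ?andbF //.
by rewrite rd_wrt eqxx z Z.add_0_r.
Qed.

Lemma record_cmdE n j m (m' := exec n (record_cmd j) m) : rd m rzero = 0%Z ->
  [/\ rd m' (rval j.+1) = rd m racc, rd m' (rflag j.+1) = 1%Z,
      forall i, i < j -> rd m' (rarg j.+1 i) = rd m (rarg j i) &
      rd m' (rarg j.+1 j) = rd m rq].
Proof.
move=> z; rewrite /m' /record_cmd [exec _ _ _]/=.
set m1 := wrt (wrt _ _ _) _ _.
have z1 : rd m1 rzero = 0%Z by rewrite /m1 !rd_wrt.
have fr r : r.1.1 != 5 -> rd (exec n (copy_cmd j (iota 0 j)) m1) r = rd m1 r.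
  move=> h; rewrite (exec_frame _ _ (writes_copy_cmd _ _)) //.
  by rewrite negb_and h.
split.
- by rewrite rd_wrt /= fr // !rd_wrt /= eqxx z Z.add_0_r.
- by rewrite rd_wrt /= fr // !rd_wrt eqxx.
- move=> i ij; rewrite rd_wrt; case: eqP => [[e]|_]; first by rewrite e ltnn in ij.
  by rewrite copy_cmdE ?mem_iota // /m1 !rd_wrt.
- by rewrite rd_wrt eqxx !fr // /m1 !rd_wrt /= z Z.add_0_r.
Qed.

Local Opaque record_cmd.

Section Scan.

Variables (k n : nat) (T : seq nat) (d : nat -> nat -> Z).
Variables (sg : seq (slot * slot)) (U : seq nat).
Hypotheses (tourT : is_tour n T) (indU : independent sg U).
Hypothesis (ltsg : forall x, x \in sg -> x.1.1 < k /\ x.2.1 < k).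

Local Notation heap_ok := (heap_ok n T d).
Local Notation lcost := (local_cost d n T sg U).

(** There is no infinite register value: if level [j.+1] is still empty, its value is first set to
    one more than the candidate, so that the comparison succeeds. *)
Definition candidate_cmd (j : nat) : cmd :=
  CIf rzero (rflag j)
    (cseq [:: local_cmd sg U j;
              CIf rzero (rflag j.+1) CSkip (CAdd (rval j.+1) racc rone);
              CIf racc (rval j.+1) (record_cmd j) CSkip])
    CSkip.

(** A free index may be placed at any q; an enumerated one only at its fixed position, and equality
    is tested by two strict comparisons. *)
Definition step_cmd (j : nat) : cmd :=
  if j \in U then CSeq (CAdd (rpos j) rq rzero) (candidate_cmd j)
  else CIf rq (rpos j) CSkip (CIf (rpos j) rq CSkip (candidate_cmd j)).

Definition step_regs (j : nat) : pred reg :=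
  fun r => [|| scratch r, level_regs j.+1 r | (r == rpos j) && (j \in U)].

Lemma writes_candidate_cmd j : writes_in (step_regs j) (candidate_cmd j).
Proof.
rewrite /candidate_cmd [writes_in _ _]/= !andbT; apply/and3P; split.
- by apply: writes_in_sub (writes_local_cmd _ _ _) => r h; rewrite /step_regs h.
- by rewrite /step_regs /level_regs eqxx !orbT.
- by apply: writes_in_sub (writes_record_cmd _) => r h; rewrite /step_regs h orbT.
Qed.

Lemma basic_candidate_cmd j : basic (candidate_cmd j).
Proof. by rewrite /= basic_local_cmd basic_record_cmd. Qed.

Lemma writes_step_cmd j : writes_in (step_regs j) (step_cmd j).
Proof.
have w := writes_candidate_cmd j.
rewrite /step_cmd; case: ifP => jU //; apply/andP; split=> //.
by rewrite /= /step_regs eqxx jU !orbT.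
Qed.

Lemma basic_step_cmd j : basic (step_cmd j).
Proof.
by have w := basic_candidate_cmd j; rewrite /step_cmd; case: ifP.
Qed.

Definition conforms (phi A : nat -> nat) : Prop :=
  forall i, i < k -> i \notin U -> A i = phi i.

Definition prefix_cost (j : nat) (A : nat -> nat) : Z :=
  \zsum_(i <- iota 0 j) lcost i A.

Definition positions_ok (phi : nat -> nat) (m : memory) : Prop :=
  forall i, i < k -> i \notin U -> rd m (rpos i) = Z.of_nat (phi i) /\ phi i < n.

Definition admissible (phi : nat -> nat) (q j : nat) (A : nat -> nat) : Prop :=
  [/\ conforms phi A, increasing j A & forall i, i < j -> A i < q].

(* The registers of level j hold an optimal choice of the first j removed
   positions among the positions below q. *)
Definition level (phi : nat -> nat) (q j : nat) (m : memory) : Prop :=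
  ((0 < rd m (rflag j))%Z -> exists2 A, admissible phi q j A &
     (forall i, i < j -> rd m (rarg j i) = Z.of_nat (A i)) /\
     rd m (rval j) = prefix_cost j A) /\
  (forall A, admissible phi q j A ->
     (0 < rd m (rflag j))%Z /\ (rd m (rval j) <= prefix_cost j A)%Z).

Lemma level_ext phi q j m m' :
  (forall r, level_regs j r -> rd m' r = rd m r) ->
  level phi q j m -> level phi q j m'.
Proof.
move=> h; rewrite /level.
have -> : rd m' (rflag j) = rd m (rflag j) by apply: h; rewrite /level_regs eqxx.
have -> : rd m' (rval j) = rd m (rval j) by apply: h; rewrite /level_regs eqxx orbT.
move=> [h1 h2]; split=> // /h1[A adm [args val]]; exists A => //; split=> // i ij.
by rewrite h ?args // /level_regs /= eqxx ?orbT.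
Qed.

Lemma prefix_costS j A : prefix_cost j.+1 A = (prefix_cost j A + lcost j A)%Z.
Proof. by rewrite /prefix_cost iotaSr -cats1 big_cat big_seq1. Qed.

Lemma lcost_conforms phi A B j : conforms phi A -> conforms phi B -> A j = B j ->
  lcost j A = lcost j B.
Proof.
move=> cA cB e; apply: local_cost_ext => // x i xs hi iU.
have ik : i < k by have [h1 h2] := ltsg xs; case: hi => ->.
by rewrite cA ?cB.
Qed.

(** The recurrence: the best choice of j + 1 positions up to q either stays below q or extends the
    best choice of j positions below q by q itself. *)
Lemma candidate_level phi q j m : heap_ok m -> q < n -> j < k ->
  rd m rq = Z.of_nat q -> rd m (rpos j) = Z.of_nat q -> positions_ok phi m ->
  level phi q j m -> level phi q j.+1 m ->
  level phi q.+1 j.+1 (exec n (candidate_cmd j) m).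
Proof.
move=> hm qn jk eq_ ej pok [snd cmp] [snd' cmp'].
have jphi : j \notin U -> phi j = q.
  by move=> /(pok j jk)[+ _]; rewrite ej => /Nat2Z.inj.
(* A representative choice that names the cost of placing j at q; any conforming choice with value q
   at j has the same local cost. *)
pose P i := if i == j then q else phi i.
have cP : conforms phi P.
  by move=> i _ iU; rewrite /P; case: eqP => // e; rewrite e jphi // -e.
have Pj : P j = q by rewrite /P eqxx.
(* an admissible choice at the new level either ignores q or ends with it *)
have split_adm A : admissible phi q.+1 j.+1 A ->
    admissible phi q j.+1 A \/ (admissible phi q j A /\ A j = q).
  move=> [cA iA lA]; have := lA j (leqnn _); rewrite ltnS leq_eqVlt => /orP[/eqP e|lt].
    right; split=> //; split=> // [i i' h1 h2|i h]; first by apply: iA => //; lia.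
    by rewrite -e; apply: iA.
  left; split=> // i; rewrite ltnS leq_eqVlt => /orP[/eqP->//|h].
  by apply: ltn_trans lt; apply: iA.
have weaken A : admissible phi q j.+1 A -> admissible phi q.+1 j.+1 A.
  by move=> [cA iA lA]; split=> // i /lA; lia.
have extend A : admissible phi q j A ->
    exists2 B, admissible phi q.+1 j.+1 B &
      [/\ forall i, i < j -> B i = A i, B j = q &
          prefix_cost j.+1 B = (prefix_cost j A + lcost j P)%Z].
  move=> [cA iA lA]; pose B i := if i == j then q else A i.
  have cB : conforms phi B.
    by move=> i ik iU; rewrite /B; case: eqP => [e|_]; [rewrite e jphi // -e|apply: cA].
  have Bj : B j = q by rewrite /B eqxx.
  have Bi i : i < j -> B i = A i by move=> ij; rewrite /B ltn_eqF.
  exists B.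
    split=> //.
    - move=> i i' h1; rewrite ltnS leq_eqVlt => /orP[/eqP e|h2].
        by rewrite e Bj Bi ?lA -?e.
      rewrite !Bi //; [exact: iA|exact: ltn_trans h2].
    - move=> i; rewrite ltnS leq_eqVlt => /orP[/eqP->|h]; first by rewrite Bj.
      by rewrite Bi //; have := lA i h; lia.
  split=> //; rewrite prefix_costS; congr (_ + _)%Z.
    rewrite /prefix_cost big_seq [RHS]big_seq; apply: eq_bigr => i.
    rewrite mem_iota => /andP[_ ij]; apply: lcost_conforms cB cA _; exact: Bi.
  by apply: lcost_conforms cB cP _; rewrite Bj Pj.
rewrite /candidate_cmd [exec _ _ _]/=.
have [[h1 h0 hn] _ _ _ _] := hm; rewrite h0.
case: Z.ltb_spec => hf; last first.
  split=> [/snd'[A adm ar]|A /split_adm[/cmp'//|[/cmp[hf' _] _]]]; last lia.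
  by exists A => //; apply: weaken.
set m1 := exec n (local_cmd sg U j) m.
have hm1 : heap_ok m1.
  apply: heap_ok_exec hm; first exact/basic_nostore/basic_local_cmd.
  exact: writes_in_sub scratch_working (writes_local_cmd _ _ _).
have [[h11 h10 _] _ _ _ _] := hm1.
have fr r : ~~ scratch r -> rd m1 r = rd m r.
  exact: (exec_frame _ _ (writes_local_cmd _ _ _)).
have eacc : rd m1 racc = (rd m (rval j) + lcost j P)%Z.
  apply: local_cmdE; rewrite ?Pj // => x i xs hi iU.
  have ik : i < k by have [a1 a2] := ltsg xs; case: hi => ->.
  have [-> lt] := pok _ ik iU; by rewrite cP.
have e1 : rd m1 (rflag j.+1) = rd m (rflag j.+1) by rewrite fr.
have e2 : rd m1 (rval j.+1) = rd m (rval j.+1) by rewrite fr.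
have e3 i : rd m1 (rarg j i) = rd m (rarg j i) by rewrite fr.
have e4 : rd m1 rq = Z.of_nat q by rewrite fr.
have e5 i : rd m1 (rarg j.+1 i) = rd m (rarg j.+1 i) by rewrite fr.
clearbody m1; rewrite h10 e1.
(* Recording is correct as soon as the candidate is no worse than every choice that stays below
   q. *)
have rec m2 : rd m2 rzero = 0%Z -> rd m2 racc = rd m1 racc ->
    (forall i, rd m2 (rarg j i) = rd m1 (rarg j i)) -> rd m2 rq = rd m1 rq ->
    (forall A, admissible phi q j.+1 A -> (rd m1 racc <= prefix_cost j.+1 A)%Z) ->
    level phi q.+1 j.+1 (exec n (record_cmd j) m2).
  move=> z2 a2 r2 q2 bound.
  have [v' f' ar' aj'] := record_cmdE n j z2; rewrite /level f' v' a2.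
  split.
    move=> _; have [A adm [ar val]] := snd hf.
    have [B admB [B1 B2 cB]] := extend A adm.
    exists B => //; split; last by rewrite eacc val cB.
    move=> i; rewrite ltnS leq_eqVlt => /orP[/eqP->|ij]; first by rewrite aj' q2 e4 B2.
    by rewrite ar' // r2 e3 ar ?B1.
  move=> A /split_adm[adm|[adm Aj]]; first by split; [lia|apply: bound].
  split; first lia.
  have [_ h] := cmp A adm; have [cA _ _] := adm.
  rewrite prefix_costS eacc (lcost_conforms cA cP) ?Aj ?Pj //; lia.
case: (Z.ltb_spec 0 (rd m (rflag j.+1))) => hf'.
  case: Z.ltb_spec; rewrite e2 => hlt.
    by apply: rec => // A /cmp'[_ h]; lia.
  rewrite /level e1 e2; split.
    move=> _; have [A adm [ar val]] := snd' hf'; exists A; first exact: weaken.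
    by split=> // i ij; rewrite e5 ar.
  move=> A /split_adm[/cmp'//|[adm Aj]]; split=> //.
  have [_ h] := cmp A adm; have [cA _ _] := adm.
  rewrite prefix_costS (lcost_conforms cA cP) ?Aj ?Pj //; lia.
rewrite !rd_wrt eqxx /= h11.
case: Z.ltb_spec => hlt; last lia.
apply: rec; rewrite ?rd_wrt //; first by move=> i; rewrite rd_wrt.
by move=> A /cmp'[h _]; lia.
Qed.

Lemma step_level phi q j m : heap_ok m -> q < n -> j < k ->
  rd m rq = Z.of_nat q -> positions_ok phi m ->
  level phi q j m -> level phi q j.+1 m ->
  level phi q.+1 j.+1 (exec n (step_cmd j) m).
Proof.
move=> hm qn jk eq_ pok lj lj1; rewrite /step_cmd; case: ifP => jU.
  have [[_ h0 _] _ _ _ _] := hm.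
  rewrite -[exec _ _ _]/(exec n (candidate_cmd j) (wrt m (rpos j) _)); apply: candidate_level => //.
  - by apply: (@heap_ok_exec _ _ _ (CAdd _ _ _)).
  - by rewrite rd_wrt.
  - by rewrite rd_wrt eqxx h0 eq_ Z.add_0_r.
  - move=> i ik iU; rewrite rd_wrt; case: eqP => [[e]|_]; last exact: pok.
    by rewrite e jU in iU.
  - apply: level_ext lj => -[[c r1] r2] h; rewrite rd_wrt; case: eqP => // -[e _ _].
    by rewrite e in h.
  - apply: level_ext lj1 => -[[c r1] r2] h; rewrite rd_wrt; case: eqP => // -[e _ _].
    by rewrite e in h.
have [ej _] := pok j jk (negbT jU).
(* A choice of length j + 1 must end at [phi j]; if q differs from it, the bounds q and q + 1 admit
   the same choices. *)
have skip : q <> phi j -> level phi q.+1 j.+1 m.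
  move=> ne; case: lj1 => snd cmp; split.
    by move=> /snd[A [cA iA lA] h]; exists A => //; split=> // i /lA; lia.
  move=> A [cA iA lA]; apply: cmp; split=> // i ij.
  have Aj : A j < q by have := lA j (leqnn _); rewrite (cA j jk (negbT jU)); lia.
  move: ij; rewrite ltnS leq_eqVlt => /orP[/eqP->//|ij].
  by apply: ltn_trans Aj; apply: iA.
rewrite -[exec _ _ _]/(if (rd m rq <? rd m (rpos j))%Z then m
  else if (rd m (rpos j) <? rd m rq)%Z then m else exec n (candidate_cmd j) m).
rewrite ej eq_.
case: Z.ltb_spec => h1; first by apply: skip; lia.
case: Z.ltb_spec => h2; first by apply: skip; lia.
by apply: candidate_level => //; rewrite ej; lia.
Qed.

(** Levels are updated in place, from the highest down: level [j'.+1] must be computed from level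
    [j'] before q has been offered to it, otherwise q could be used twice. *)
Fixpoint down_cmd (j : nat) : cmd :=
  if j is j'.+1 then CSeq (step_cmd j') (down_cmd j') else CSkip.

Definition down_regs (j : nat) : pred reg :=
  fun r => [|| scratch r, [exists i : 'I_j, level_regs i.+1 r] |
               (r.1.1 == 2) && (r.1.2 \in U)].

Lemma step_regs_down j : subpred (step_regs j) (down_regs j.+1).
Proof.
move=> r /or3P[h|h|/andP[/eqP-> jU]]; rewrite /down_regs ?h //.
  by apply/or3P/Or32/existsP; exists ord_max.
by rewrite /= jU !orbT.
Qed.

Lemma writes_down_cmd j : writes_in (down_regs j) (down_cmd j).
Proof.
elim: j => //= j ih; apply/andP; split.
  exact: writes_in_sub (@step_regs_down j) (writes_step_cmd j).
apply: writes_in_sub ih => r /or3P[h|/existsP[i h]|h]; rewrite /down_regs ?h ?orbT //.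
by apply/or3P/Or32/existsP; exists (widen_ord (leqnSn j) i).
Qed.

Lemma basic_down_cmd j : basic (down_cmd j).
Proof. by elim: j => //= j ->; rewrite basic_step_cmd. Qed.

Lemma level_regs_class j r : level_regs j r -> (2 < r.1.1) && (r.1.1 < 6) && (r.1.2 == j).
Proof. by rewrite /level_regs => /or3P[/eqP->|/eqP->|/andP[/eqP-> ->]]; rewrite /= ?eqxx. Qed.

Lemma down_regs_class j r : down_regs j r ->
  scratch r || (1 < r.1.1) && (r.1.1 < 6).
Proof.
case/or3P => [->//|/existsP[i /level_regs_class/andP[/andP[h1 h2] _]]|/andP[/eqP-> _]].
  by rewrite h2 (ltnW h1) orbT.
by rewrite orbT.
Qed.

Lemma down_regs_working j : subpred (down_regs j) working.
Proof.
move=> r /down_regs_class/orP[/scratch_working//|/andP[h1 _]].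
by case: r h1 => [[[|[|c]] r1] r2].
Qed.

Lemma down_level phi q j m : heap_ok m -> q < n -> j <= k ->
  rd m rq = Z.of_nat q -> positions_ok phi m ->
  (forall i, i <= j -> level phi q i m) ->
  forall i, i <= j -> level phi q.+1 i (exec n (down_cmd j) m).
Proof.
move=> hm qn; elim: j m hm => [|j ih] m hm jk eq_ pok lev i ij.
  move: ij; rewrite leqn0 => /eqP-> /=.
  have [snd cmp] := lev 0 (leqnn _); split.
    by move=> /snd[A [cA iA lA] h]; exists A => //; split.
  by move=> A [cA iA lA]; apply: cmp; split.
rewrite -[exec _ _ _]/(exec n (down_cmd j) (exec n (step_cmd j) m)).
set m1 := exec n (step_cmd j) m.
have hm1 : heap_ok m1.
  apply: heap_ok_exec hm; first exact/basic_nostore/basic_step_cmd.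
  apply: writes_in_sub (writes_step_cmd j) => r /step_regs_down.
  exact: down_regs_working.
have fr r : ~~ step_regs j r -> rd m1 r = rd m r.
  exact: (exec_frame _ _ (writes_step_cmd j)).
have l1 : level phi q.+1 j.+1 m1 by apply: step_level => //; apply: lev.
(* The update at j writes level j + 1 only, so the lower levels are still those for q. *)
have low i' : i' <= j -> level phi q i' m1.
  move=> h; apply: level_ext (lev i' (leqW h)) => r hr; apply: fr.
  apply/negP => /or3P[h1|h1|/andP[/eqP h1 _]].
  - have := level_regs_class hr; move: h1; rewrite /scratch !inE => /or3P[]/eqP->//.
  - have /andP[_ /eqP e1] := level_regs_class hr.
    by have /andP[_] := level_regs_class h1; rewrite e1 => /eqP e; lia.
  - by have := level_regs_class hr; rewrite h1.
have [le|gt] := leqP i j.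
  apply: ih low _ le => //; first exact: ltnW.
    by rewrite fr.
  move=> i' ik iU; rewrite fr; first exact: pok.
  rewrite /step_regs /level_regs /scratch !inE /=.
  by apply/negP => /andP[/eqP[e] jU]; rewrite e jU in iU.
have -> : i = j.+1 by lia.
apply: level_ext l1 => r hr; apply: (exec_frame _ _ (writes_down_cmd j)).
apply/negP => /or3P[h1|/existsP[i' h1]|/andP[/eqP h1 _]].
- have := level_regs_class hr; move: h1; rewrite /scratch !inE => /or3P[]/eqP->//.
- have /andP[_ /eqP e1] := level_regs_class hr.
  have /andP[_] := level_regs_class h1; rewrite e1 => /eqP e.
  by have := ltn_ord i'; lia.
- by have := level_regs_class hr; rewrite h1.
Qed.

End Scan.

(** * Enumeration of the dependent positions *)

Definition clear_cmd (s : seq nat) : cmd := cseq [seq CConst (rflag j) 0 | j <- s].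

Lemma clear_cmdE n s m j : 
  rd (exec n (clear_cmd s) m) (rflag j) = if j \in s then 0%Z else rd m (rflag j).
Proof.
elim: s m => // a s ih m; rewrite /= -/(clear_cmd s) ih inE rd_wrt.
have -> : (rflag j == rflag a) = (j == a) by apply/eqP/eqP => [[]|->].
by case: (j \in s); case: eqP.
Qed.

Lemma writes_clear_cmd s : writes_in (fun r => r.1.1 == 3) (clear_cmd s).
Proof. by rewrite writes_in_cseq all_map; apply/allP. Qed.

Lemma basic_clear_cmd s : basic (clear_cmd s).
Proof. by rewrite basic_cseq all_map; apply/allP. Qed.

Local Opaque clear_cmd.

Fixpoint outs_cmd (k t : nat) (es : seq (slot * slot)) : cmd :=
  if es is x :: es' then
    cseq [:: fetch (rout t 0) (rarg k x.1.1) x.1.2;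
             fetch (rout t 1) (rarg k x.2.1) x.2.2; outs_cmd k t.+1 es']
  else CSkip.

Definition reg_edge (m : memory) (t : nat) : nat * nat :=
  edge (Z.to_nat (rd m (rout t 0))) (Z.to_nat (rd m (rout t 1))).

Lemma writes_outs_cmd k t es :
  writes_in (fun r => (r.1.1 == 6) && (t <= r.1.2)) (outs_cmd k t es).
Proof.
elim: es t => //= x es ih t; rewrite !writes_fetch /= !leqnn andbT /=.
by apply: writes_in_sub (ih t.+1) => r /andP[-> h]; rewrite ltnW.
Qed.

Lemma basic_outs_cmd k t es : basic (outs_cmd k t es).
Proof. by elim: es t => //= x es ih t; rewrite !basic_fetch ih. Qed.

Lemma outs_cmdE n T d k t es m A : is_tour n T -> heap_ok n T d m ->
  (forall x i, x \in es -> i = x.1.1 \/ i = x.2.1 ->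
     rd m (rarg k i) = Z.of_nat (A i) /\ A i < n) ->
  map (reg_edge (exec n (outs_cmd k t es) m)) (iota t (size es)) = added n T A es.
Proof.
move=> tourT; elim: es t m => // x es ih t m hm hA.
have [e1 l1] := hA x x.1.1 (mem_head _ _) (or_introl erefl).
have [e2 l2] := hA x x.2.1 (mem_head _ _) (or_intror erefl).
rewrite -[exec _ _ _]/(exec n (outs_cmd k t.+1 es)
  (exec n (fetch (rout t 1) (rarg k x.2.1) x.2.2)
     (exec n (fetch (rout t 0) (rarg k x.1.1) x.1.2) m))).
set m1 := exec n (fetch (rout t 0) (rarg k x.1.1) x.1.2) m.
have f1 : rd m1 (rout t 0) = Z.of_nat (vtx n T A x.1).
  exact: (@fetchE _ _ _ _ (rout t 0) _ _ _ hm isT e1 l1).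
have hm1 : heap_ok n T d m1.
  by apply: heap_ok_exec => //; [apply/basic_nostore/basic_fetch|rewrite writes_fetch].
have r1 r : r.1.1 != 6 -> rd m1 r = rd m r.
  move=> h; apply: (@exec_frame _ (fun r => r.1.1 == 6)) h; by rewrite writes_fetch.
clearbody m1.
set m2 := exec n _ m1.
have f2 : rd m2 (rout t 1) = Z.of_nat (vtx n T A x.2).
  apply: (@fetchE _ _ _ _ (rout t 1) _ _ _ hm1 isT _ l2); by rewrite r1.
have {}f1 : rd m2 (rout t 0) = Z.of_nat (vtx n T A x.1).
  rewrite (@exec_frame n (fun r => r.2 == 1)) ?writes_fetch //.
have hm2 : heap_ok n T d m2.
  by apply: heap_ok_exec => //; [apply/basic_nostore/basic_fetch|rewrite writes_fetch].
have r2 r : r.1.1 != 6 -> rd m2 r = rd m r.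
  move=> h; rewrite -r1 //; apply: (@exec_frame _ (fun r => r.1.1 == 6)) h.
  by rewrite writes_fetch.
clearbody m2.
rewrite /= ih //; last first.
  by move=> y i ye hi; rewrite r2 //; apply: (hA y) => //; rewrite inE ye orbT.
congr (_ :: _); rewrite /reg_edge.
by rewrite !(exec_frame _ _ (writes_outs_cmd _ _ _)) /= ?ltnn // f1 f2 !Nat2Z.id.
Qed.

Local Opaque outs_cmd.

Definition output_slots (k : nat) (sg : seq (slot * slot)) : seq (slot * slot) :=
  [seq ((i, false), (i, true)) | i <- iota 0 k] ++ sg.

(** Level 0 holds the empty choice at cost 0; lowering the other flags suffices to discard the
    previous sweep. *)
Definition init_cmd (k : nat) : cmd :=
  cseq [:: CConst (rflag 0) 1; CConst (rval 0) 0; clear_cmd (iota 1 k)].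

(** The endpoints are saved at once, since the next sweep overwrites the level registers. *)
Definition report_cmd (k : nat) (sg : seq (slot * slot)) : cmd :=
  CIf rzero (rflag k)
    (CIf (rval k) rbest
      (CSeq (CAdd rbest (rval k) rzero) (outs_cmd k 0 (output_slots k sg))) CSkip)
    CSkip.

Definition inner_cmd (k : nat) (sg : seq (slot * slot)) (U : seq nat) : cmd :=
  cseq [:: init_cmd k; CFor rq (down_cmd sg U k); report_cmd k sg].

(** Among the position registers only those of [U] occur, so the counters of the enumerating loops
    are untouched, as [wf] demands. *)
Definition inner_regs (U : seq nat) : pred reg :=
  fun r => [|| scratch r, r == rq, r == rbest, 2 < r.1.1 | (r.1.1 == 2) && (r.1.2 \in U)].

Lemma down_regs_inner U j : subpred (down_regs U j) (inner_regs U).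
Proof.
move=> r /or3P[h|/existsP[i /level_regs_class/andP[/andP[h _] _]]|h];
by rewrite /inner_regs h ?orbT.
Qed.

Lemma writes_init_cmd k : writes_in (fun r => (2 < r.1.1) && (r.1.1 < 5)) (init_cmd k).
Proof.
rewrite /= andbT; apply: writes_in_sub (writes_clear_cmd _) => r; by move=> /eqP->.
Qed.

Lemma writes_report_cmd k sg :
  writes_in (fun r => (r == rbest) || (r.1.1 == 6)) (report_cmd k sg).
Proof.
rewrite /= !andbT; apply: writes_in_sub (writes_outs_cmd _ _ _) => r.
by move=> /andP[-> _]; rewrite orbT.
Qed.

Lemma writes_inner_cmd k sg U : writes_in (inner_regs U) (inner_cmd k sg U).
Proof.
rewrite writes_in_cseq; apply/and4P; split=> //.
- by apply: writes_in_sub (writes_init_cmd k) => r /andP[h _]; rewrite /inner_regs h !orbT.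
- apply/andP; split; first by [].
  exact: writes_in_sub (@down_regs_inner U k) (writes_down_cmd _ _ _).
- apply: writes_in_sub (writes_report_cmd k sg) => r /orP[/eqP->|/eqP h] //.
  by rewrite /inner_regs h !orbT.
Qed.

Lemma basic_init_cmd k : basic (init_cmd k).
Proof. by rewrite /= basic_clear_cmd. Qed.

Lemma basic_report_cmd k sg : basic (report_cmd k sg).
Proof. by rewrite /= basic_outs_cmd. Qed.

Lemma inner_regs_working U : subpred (inner_regs U) working.
Proof.
move=> r /orP[/scratch_working//|/or4P[/eqP->|/eqP->|h|/andP[/eqP h _]]] //;
by case: r h => [[[|[|c]] r1] r2].
Qed.

Lemma nostore_inner_cmd k sg U : nostore (inner_cmd k sg U).
Proof.
rewrite nostore_cseq; apply/and4P; split=> //.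
- exact/basic_nostore/basic_init_cmd.
- exact: (basic_nostore (basic_down_cmd sg U k)).
- exact/basic_nostore/basic_report_cmd.
Qed.

Lemma wf_inner_cmd k sg U : wf (inner_cmd k sg U).
Proof.
rewrite wf_cseq; apply/and4P; split=> //.
- by case: (basicP (basic_init_cmd k)).
- apply/andP; split; last by case: (basicP (basic_down_cmd sg U k)).
  apply: writes_in_sub (writes_down_cmd _ _ _) => r /down_regs_class h.
  by apply: contraTneq h => ->.
- by case: (basicP (basic_report_cmd k sg)).
Qed.

Lemma depth_inner_cmd k sg U : depth (inner_cmd k sg U) <= 1.
Proof.
apply: depth_cseq; apply/and4P; split=> //.
- by case: (basicP (basic_init_cmd k)) => _ _ ->.
- by rewrite [depth _]/= ; case: (basicP (basic_down_cmd sg U k)) => _ _ ->.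
- by case: (basicP (basic_report_cmd k sg)) => _ _ ->.
Qed.

Section Search.

Variables (k n : nat) (T : seq nat) (d : nat -> nat -> Z).
Hypotheses (tourT : is_tour n T) (k0 : 0 < k).
Hypothesis symd : forall i j, i < n -> j < n -> d i j = d j i.

(** The value 0 means that no improving move is known yet; the output registers are meaningful only
    below it. *)
Definition best_ok (m : memory) : Prop :=
  (rd m rbest <= 0)%Z /\
  ((rd m rbest < 0)%Z -> exists X Y,
     [/\ is_kmove k n T X Y, delta d X Y = rd m rbest &
         X ++ Y = map (reg_edge m) (iota 0 (k + k))]).

Definition good (m : memory) : Prop := heap_ok n T d m /\ best_ok m.

Lemma best_ok_ext m m' : (forall r, r = rbest \/ r.1.1 = 6 -> rd m' r = rd m r) ->
  best_ok m -> best_ok m'.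
Proof.
move=> h [h1 h2]; rewrite /best_ok h; last by left.
split=> // /h2[X [Y [mv dl e]]]; exists X, Y; split=> //; rewrite e.
by apply: eq_map => t; rewrite /reg_edge !h //; right.
Qed.

Section Word.

Variables (w : seq (nat * bool)) (U : seq nat).
Hypotheses (ww : is_word k w) (indU : independent (signature k w) U).

Local Notation sg := (signature k w).

Let ltsg := @signature_lt k w k0 ww.

Lemma prefix_cost_move A : prefix_cost n T d sg U k A = move_cost d k n T sg A.
Proof. by rewrite /prefix_cost (move_cost_local _ _ _ U). Qed.

(** No position lies below 0, so only the empty choice is admissible at the start. *)
Lemma init_level phi m j : j <= k ->
  level k n T d sg U phi 0 j (exec n (init_cmd k) m).
Proof.
move=> jk; rewrite /level /= !clear_cmdE mem_iota.
case: j jk => [|j] jk.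
  rewrite (exec_frame _ _ (writes_clear_cmd _)) // !rd_wrt eqxx /=.
  split=> [_|A _].
    by exists phi => //; split=> //; rewrite /prefix_cost big_nil.
  by rewrite /prefix_cost big_nil.
rewrite /= ltnS jk; split=> // A [_ _ lA]; have := lA 0 isT; lia.
Qed.

Lemma positions_ok_ext phi m m' :
  (forall i, i < k -> i \notin U -> rd m' (rpos i) = rd m (rpos i)) ->
  positions_ok k n U phi m -> positions_ok k n U phi m'.
Proof. by move=> h pok i ik iU; rewrite h //; apply: pok. Qed.

Lemma scan_level phi m : heap_ok n T d m -> positions_ok k n U phi m ->
  (forall j, j <= k -> level k n T d sg U phi 0 j m) ->
  level k n T d sg U phi n k (exec n (CFor rq (down_cmd sg U k)) m).
Proof.
move=> hm pok lev.
pose I i m := [/\ heap_ok n T d m, positions_ok k n U phi m &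
  forall j, j <= k -> level k n T d sg U phi i j m].
have Iq i m' v : I i m' -> I i (wrt m' rq v).
  move=> [h1 h2 h3]; split.
  - by apply: (@heap_ok_exec _ _ _ (CConst rq v)).
  - by apply: positions_ok_ext h2 => j _ _; rewrite rd_wrt.
  - move=> j jk; apply: level_ext (h3 j jk) => r /level_regs_class h.
    by rewrite rd_wrt; case: eqP => // e; rewrite e in h.
suff [_ _ h] : I n (exec n (CFor rq (down_cmd sg U k)) m) by apply: h.
apply: exec_for; first exact: Iq.
move=> i m' lt [h1 h2 h3] ei.
have fr r : ~~ down_regs U k r -> rd (exec n (down_cmd sg U k) m') r = rd m' r.
  exact: (exec_frame _ _ (writes_down_cmd _ _ _)).
have hm' : heap_ok n T d (exec n (down_cmd sg U k) m').
  apply: heap_ok_exec h1; first exact/basic_nostore/basic_down_cmd.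
  exact: writes_in_sub (@down_regs_working U k) (writes_down_cmd _ _ _).
split.
- by rewrite fr //; apply/negP => /down_regs_class.
- by case: hm' => -[].
- apply: Iq; split=> //.
    apply: positions_ok_ext h2 => j jk jU; apply: fr.
    apply/negP => /or3P[//|/existsP[a /level_regs_class//]|/andP[_ /= h]].
    by rewrite h in jU.
  exact: down_level.
Qed.

Lemma report_spec phi m : good m -> level k n T d sg U phi n k m ->
  let m' := exec n (report_cmd k sg) m in
  [/\ good m', (rd m' rbest <= rd m rbest)%Z &
      forall A, admissible k U phi n k A -> (rd m' rbest <= move_cost d k n T sg A)%Z].
Proof.
move=> [hm bm] [snd cmp] m'.
have hm' : heap_ok n T d m'.
  apply: heap_ok_exec hm; first exact/basic_nostore/basic_report_cmd.
  apply: writes_in_sub (writes_report_cmd k sg) => r /orP[/eqP->//|/eqP h].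
  by case: r h => [[[|[|c]] r1] r2].
move: hm'; rewrite {}/m' /report_cmd.
rewrite -[exec _ _ _]/(if (rd m rzero <? rd m (rflag k))%Z then
   if (rd m (rval k) <? rd m rbest)%Z then
     exec n (outs_cmd k 0 (output_slots k sg)) (exec n (CAdd rbest (rval k) rzero) m)
   else m else m).
have [[h1 h0 hn] _ _ _ _] := hm; rewrite h0.
case: Z.ltb_spec => hf; last first.
  by move=> _; split=> // [|A /cmp[]]; [exact: Z.le_refl|lia].
case: Z.ltb_spec => hb; last first.
  move=> _; split=> // [|A /cmp[_]]; first exact: Z.le_refl.
  by rewrite prefix_cost_move; lia.
set m1 := exec n (CAdd _ _ _) m; set m2 := exec n _ m1 => hm2.
have [A [cA iA lA] [ar val]] := snd hf.
have e1 : rd m1 rbest = rd m (rval k) by rewrite /= rd_wrt eqxx h0 Z.add_0_r.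
have e2 : rd m2 rbest = rd m (rval k).
  by rewrite (exec_frame _ _ (writes_outs_cmd _ _ _)).
have mv := word_is_kmove tourT k0 iA lA ww.
have eo : map (reg_edge m2) (iota 0 (size (output_slots k sg))) =
          added n T A (output_slots k sg).
  apply: (outs_cmdE (d := d)) => //.
    by apply: (@heap_ok_exec _ _ _ (CAdd _ _ _)).
  move=> x i; rewrite mem_cat => hx hi.
  have ik : i < k.
    case/orP: hx => [/mapP[j]|/ltsg[a b]]; last by case: hi => ->.
    by rewrite mem_iota => /andP[_ jk] e; case: hi => ->; rewrite e.
  by rewrite /m1 /= rd_wrt /= ar // lA.
have val' : rd m2 rbest = move_cost d k n T sg A by rewrite e2 val prefix_cost_move.
have best0 : (rd m rbest <= 0)%Z by case: bm.
split.
- split=> //; split; first lia.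
  move=> _; exists (removed k n T A), (added n T A sg); split=> //.
    by rewrite val' delta_move_cost.
  have -> : removed k n T A ++ added n T A sg = added n T A (output_slots k sg).
    by rewrite /output_slots /added map_cat -map_comp.
  rewrite -eo; congr (map _ (iota _ _)).
  rewrite size_cat size_map size_iota; congr (_ + _).
  by case: mv => _ [_]; rewrite size_map.
- lia.
- by move=> B /cmp[_]; rewrite e2 prefix_cost_move.
Qed.

Lemma inner_spec phi m : good m -> positions_ok k n U phi m ->
  let m' := exec n (inner_cmd k sg U) m in
  [/\ good m', (rd m' rbest <= rd m rbest)%Z &
      forall A, admissible k U phi n k A -> (rd m' rbest <= move_cost d k n T sg A)%Z].
Proof.
move=> [hm bm] pok.
rewrite /inner_cmd -[exec _ _ _]/(exec n (report_cmd k sg)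
  (exec n (CFor rq (down_cmd sg U k)) (exec n (init_cmd k) m))).
set m1 := exec n (init_cmd k) m.
have w1 := writes_init_cmd k.
have hm1 : heap_ok n T d m1.
  apply: heap_ok_exec hm; first exact/basic_nostore/basic_init_cmd.
  by apply: writes_in_sub w1 => -[[[|[|c]] r1] r2].
have pok1 : positions_ok k n U phi m1.
  by apply: positions_ok_ext pok => i _ _; rewrite (exec_frame _ _ w1).
have lev1 j : j <= k -> level k n T d sg U phi 0 j m1 by apply: init_level.
have bm1 : best_ok m1.
  by apply: best_ok_ext bm => r hr; rewrite (exec_frame _ _ w1) //; case: hr => ->.
have b1 : rd m1 rbest = rd m rbest by rewrite (exec_frame _ _ w1).
clearbody m1.
have lev2 := scan_level hm1 pok1 lev1.
set c2 := CFor _ _ in lev2 *; set m2 := exec n c2 m1 in lev2 *.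
have w2 : writes_in (fun r => (r == rq) || down_regs U k r) c2.
  apply/andP; split=> //; apply: writes_in_sub (writes_down_cmd _ _ _) => r h.
  by rewrite h orbT.
have fr2 r : r = rbest \/ r.1.1 = 6 -> rd m2 r = rd m1 r.
  move=> hr; apply: (exec_frame _ _ w2); apply/negP => /orP[/eqP e|/down_regs_class h].
    by case: hr; rewrite e.
  case: hr => [e|e]; first by rewrite e in h.
  by case: r e h => [[c r1] r2] /= ->.
have hm2 : heap_ok n T d m2.
  apply: heap_ok_exec hm1; first exact: (basic_nostore (basic_down_cmd sg U k)).
  by apply: writes_in_sub w2 => r /orP[/eqP->//|/down_regs_working].
have [|g b c] := report_spec _ lev2; first by split=> //; apply: best_ok_ext bm1.
by split=> //; rewrite -b1 -fr2 //; left.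
Qed.

End Word.

End Search.

Fixpoint nest (F : seq nat) (c : cmd) : cmd :=
  if F is f :: F' then CFor (rpos f) (nest F' c) else c.

Lemma writes_nest p F c : writes_in p (nest F c) = all (fun f => p (rpos f)) F && writes_in p c.
Proof. by elim: F => //= f F ->; rewrite andbA. Qed.

Lemma nostore_nest F c : nostore (nest F c) = nostore c.
Proof. by elim: F. Qed.

Lemma depth_nest F c : depth (nest F c) = size F + depth c.
Proof. by elim: F => //= f F ->. Qed.

Lemma wf_nest F c : uniq F -> {in F, forall f, writes_in (predC1 (rpos f)) c} ->
  wf c -> wf (nest F c).
Proof.
elim: F => //= f F ih /andP[fF uF] h wc; rewrite ih //; last first.
  by move=> g gF; apply: h; rewrite inE gF orbT.
rewrite writes_nest h ?mem_head // !andbT; apply/allP => g gF /=.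
by apply: contraNneq fF => -[<-].
Qed.

Section Nest.

Variables (k n : nat) (T : seq nat) (d : nat -> nat -> Z).
Hypotheses (tourT : is_tour n T) (k0 : 0 < k).
Hypothesis symd : forall i j, i < n -> j < n -> d i j = d j i.
Variables (w : seq (nat * bool)) (U : seq nat).
Hypotheses (ww : is_word k w) (indU : independent (signature k w) U).

Local Notation sg := (signature k w).

(** [phi] records the enumerated positions outside the loops of [F]. Enumerated values need not be
    increasing: for a bad tuple no choice is admissible and the sweep leaves level k empty. *)
Lemma nest_spec phi F m : uniq F -> {in F, forall f, (f < k) && (f \notin U)} ->
  good k n T d m ->
  (forall i, i < k -> i \notin U -> i \notin F ->
     rd m (rpos i) = Z.of_nat (phi i) /\ phi i < n) ->
  let m' := exec n (nest F (inner_cmd k sg U)) m in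
  [/\ good k n T d m', (rd m' rbest <= rd m rbest)%Z &
      forall A, increasing k A -> (forall i, i < k -> A i < n) ->
        (forall i, i < k -> i \notin U -> i \notin F -> A i = phi i) ->
        (rd m' rbest <= move_cost d k n T sg A)%Z].
Proof.
elim: F phi m => [|f F ih] phi m.
  move=> _ _ gm pok m'; have [|g b c] := @inner_spec k n T d tourT k0 symd w U ww indU phi m gm.
    by move=> i ik iU; apply: pok.
  by split=> // A iA lA cA; apply: c; split=> // i ik iU; apply: cA.
move=> /andP[fF uF] hF gm pok m'.
have /andP[fk fU] := hF f (mem_head _ _).
have hF' : {in F, forall f, (f < k) && (f \notin U)}.
  by move=> g gF; apply: hF; rewrite inE gF orbT.
(* The bound is claimed only for choices whose value at [f] was already tried; at i = n this
   restriction is void. *)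
pose I i m1 := [/\ good k n T d m1, (rd m1 rbest <= rd m rbest)%Z,
   (forall i, i < k -> i \notin U -> i \notin f :: F ->
     rd m1 (rpos i) = Z.of_nat (phi i) /\ phi i < n) &
   forall A, increasing k A -> (forall i, i < k -> A i < n) ->
     (forall i, i < k -> i \notin U -> i \notin f :: F -> A i = phi i) ->
     A f < i -> (rd m1 rbest <= move_cost d k n T sg A)%Z].
have Iw i m1 v : I i m1 -> I i (wrt m1 (rpos f) v).
  move=> [[h1 h2] h3 h4 h5]; rewrite /I rd_wrt /=; split=> //.
  - split; first by apply: (@heap_ok_exec _ _ _ (CConst (rpos f) v)).
    apply: best_ok_ext h2 => r hr; rewrite rd_wrt; case: eqP => // e.
    by case: hr; rewrite e.
  - move=> j jk jU jF; rewrite rd_wrt; case: eqP => [[e]|_]; last exact: h4.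
    by rewrite e mem_head in jF.
have fin : I n m'.
  apply: exec_for.
    by apply: Iw; split=> //; exact: Z.le_refl.
  move=> i m1 lti [g1 b1 p1 c1] ei.
  pose phi' j := if j == f then i else phi j.
  have [|g2 b2 c2] := ih phi' m1 uF hF' g1.
    move=> j jk jU jF; rewrite /phi'; case: eqP => [->//|/eqP ne].
    by apply: p1 => //; rewrite inE negb_or ne.
  have wr : writes_in (fun r => inner_regs U r || [exists g : 'I_k, (val g \in F) && (r == rpos g)])
       (nest F (inner_cmd k sg U)).
    rewrite writes_nest; apply/andP; split.
      apply/allP => g gF; apply/orP; right; apply/existsP.
      have /andP[gk _] := hF' g gF; exists (Ordinal gk); by rewrite /= gF eqxx.
    by apply: writes_in_sub (writes_inner_cmd _ _ _) => r ->.
  have fr j : j \notin U -> j \notin F ->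
      rd (exec n (nest F (inner_cmd k sg U)) m1) (rpos j) = rd m1 (rpos j).
    move=> jU jF; apply: (exec_frame _ _ wr); rewrite negb_or; apply/andP; split.
      by rewrite /inner_regs /= (negPf jU).
    by apply/existsP => -[g /andP[gF /eqP[e]]]; rewrite e gF in jF.
  split.
  - by rewrite fr.
  - by case: g2 => -[[]].
  - apply: Iw; split=> //.
    + exact: Z.le_trans b1.
    + move=> j jk jU jF; rewrite fr //; first exact: p1.
      by apply: contra jF; rewrite inE => ->; rewrite orbT.
    + move=> A iA lA cA; rewrite ltnS leq_eqVlt => /orP[/eqP e|lt].
        apply: c2 => // j jk jU jF; rewrite /phi'; case: eqP => [->//|/eqP ne].
        by apply: cA => //; rewrite inE negb_or ne.
      apply: Z.le_trans b2 _; exact: c1.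
case: fin => g b _ c; split=> // A iA lA cA.
by apply: c => //; apply: lA.
Qed.

End Nest.

(** * The complete program *)

Lemma word_program k w : 0 < k -> is_word k w ->
  exists c, [/\ wf c, writes_in working c, nostore c, depth c <= (2 * k) %/ 3 + 1 &
    forall n T d m, is_tour n T ->
      (forall i j, i < n -> j < n -> d i j = d j i) -> good k n T d m ->
      let m' := exec n c m in
      [/\ good k n T d m', (rd m' rbest <= rd m rbest)%Z &
        forall A, increasing k A -> (forall i, i < k -> A i < n) ->
          (rd m' rbest <= move_cost d k n T (signature k w) A)%Z]].
Proof.
move=> k0 ww.
have [U [subU uU sU indU]] := greedy_independent k0 ww (iota_uniq 0 k).
pose F := [seq i <- iota 0 k | i \notin U].
have hF f : f \in F -> (f < k) && (f \notin U).
  by rewrite mem_filter mem_iota andbC.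
have uF : uniq F by rewrite filter_uniq ?iota_uniq.
have sF : size F = k - size U.
  have := count_predC (mem U) (iota 0 k); rewrite size_iota.
  have -> : count (mem U) (iota 0 k) = size U.
    rewrite -size_filter; apply/perm_size/uniq_perm => //.
      by rewrite filter_uniq ?iota_uniq.
    move=> i; rewrite mem_filter; apply/andP/idP => [[]//|iU].
    by split=> //; apply: subU.
  by rewrite /F size_filter; move: (count _ _) => a; lia.
exists (nest F (inner_cmd k (signature k w) U)); split.
- apply: wf_nest => //; last exact: wf_inner_cmd.
  move=> f /hF/andP[fk fU]; apply: writes_in_sub (writes_inner_cmd _ _ _) => r h.
  by apply: contraTneq h => ->; rewrite /inner_regs /= (negPf fU).
- rewrite writes_nest; apply/andP; split; first by apply/allP.
  exact: writes_in_sub (@inner_regs_working U) (writes_inner_cmd _ _ _).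
- by rewrite nostore_nest nostore_inner_cmd.
(* From k <= 3|U| follows 3(k - |U|) <= 2k; the remaining 1 is the sweep. *)
- rewrite depth_nest; apply: leq_add (depth_inner_cmd _ _ _); rewrite sF.
  by move: sU; rewrite size_iota leq_divRL //; lia.
- move=> n T d m tourT symd gm m'.
  have [||g b c] := @nest_spec k n T d tourT k0 symd w U ww indU id F m uF _ gm.
  + exact: hF.
  + by move=> i ik iU; rewrite mem_filter iU mem_iota /= ik.
  split=> // A iA lA; apply: c => // i ik iU.
  by rewrite mem_filter iU mem_iota /= ik.
Qed.

(** Programs for different words run one after another; depth is a maximum under sequencing, so the
    exponent does not grow with their number. *)
Lemma words_program k (ws : seq (seq (nat * bool))) : 0 < k ->
  {in ws, forall w, is_word k w} ->
  exists c, [/\ wf c, writes_in working c, nostore c, depth c <= (2 * k) %/ 3 + 1 &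
    forall n T d m, is_tour n T ->
      (forall i j, i < n -> j < n -> d i j = d j i) -> good k n T d m ->
      let m' := exec n c m in
      [/\ good k n T d m', (rd m' rbest <= rd m rbest)%Z &
        forall w A, w \in ws -> increasing k A -> (forall i, i < k -> A i < n) ->
          (rd m' rbest <= move_cost d k n T (signature k w) A)%Z]].
Proof.
move=> k0; elim: ws => [|w ws ih] hws.
  by exists CSkip; split=> // n T d m _ _ gm m'; split=> //; apply: Z.le_refl.
have [c1 [wf1 w1 n1 d1 s1]] := word_program k0 (hws w (mem_head _ _)).
have [|c2 [wf2 w2 n2 d2 s2]] := ih.
  by move=> v vw; apply: hws; rewrite inE vw orbT.
exists (CSeq c1 c2); split; rewrite /= ?wf1 ?w1 ?n1 ?geq_max ?d1 //.
move=> n T d m tourT symd gm.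
have [g b c] := s1 n T d m tourT symd gm.
have [g' b' c'] := s2 n T d _ tourT symd g.
split=> //; first exact: Z.le_trans b' b.
move=> v A; rewrite inE => /orP[/eqP->|vw] iA lA; last exact: c'.
by apply: Z.le_trans b' _; apply: c.
Qed.

(** Rotations and reflections of a word describe the same moves and are listed repeatedly; the
    number of words is a constant in any case. *)
Definition all_words (k : nat) : seq (seq (nat * bool)) :=
  [seq zip s (val b) | s <- permutations (iota 0 k), b <- enum {: k.-tuple bool}].

Lemma all_wordsP k w : reflect (is_word k w) (w \in all_words k).
Proof.
apply: (iffP allpairsP) => [[[s b] /= [+ _ ->]]|ww].
  rewrite mem_permutations => ps; rewrite /is_word -/(unzip1 _) unzip1_zip //.
  by rewrite size_tuple (perm_size ps) size_iota.
have sw : size (unzip2 w) == k.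
  by rewrite size_map -(size_map fst) (perm_size ww) size_iota.
exists (unzip1 w, Tuple sw); split=> /=; [by rewrite mem_permutations|by rewrite mem_enum|].
by rewrite zip_unzip.
Qed.

(** Products are formed by repeated addition: the first loop adds n*n to n + 1, the second writes
    the row addresses, each n more than the last. *)
Definition table_cmd : cmd :=
  cseq [:: CAdd rbase rsize rone; CFor rq (CAdd rbase rbase rsize);
           CAdd racc rsize rone;
           CFor rq (cseq [:: CAdd rtmp rbase rq; CStore rtmp racc;
                             CAdd racc racc rsize]);
           CConst rbest 0].

Lemma init_mem_tour n T d i : i < n ->
  init_mem n T d (Z.of_nat i + 1)%Z = Z.of_nat (nth 0 T i).
Proof.
move=> lt; rewrite /init_mem.
case: Z.eqb_spec => [|_]; first lia.
have -> : ((1 <=? Z.of_nat i + 1) && (Z.of_nat i + 1 <=? Z.of_nat n))%Z by lia.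
by congr (Z.of_nat (nth _ _ _)); lia.
Qed.

Lemma init_mem_dist n T d u v : u < n -> v < n ->
  init_mem n T d (Z.of_nat (n + 1 + u * n + v)) = d u v.
Proof.
move=> lu lv; rewrite /init_mem.
have le : u * n + v < n * n.
  by apply: (@leq_trans (u * n + n)); [rewrite ltn_add2l|rewrite addnC -mulSn leq_mul2r lu orbT].
move: (u * n) le (divnMDl u v (leq_ltn_trans (leq0n v) lv)) (modnMDl u v n) => a le ed em.
case: Z.eqb_spec => [|_]; first lia.
rewrite (_ : (_ && _)%Z = false); last by lia.
move: (n * n) le => b le.
rewrite (_ : (_ && _)%Z = true); last by lia.
have -> : Z.to_nat (Z.of_nat (n + 1 + a + v)) - n.+1 = a + v by lia.
by rewrite ed em divn_small // addn0 modn_small.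
Qed.

Lemma table_cmdE n T d m : 0 < n -> consts_ok n m ->
  (forall a, (0 <= a)%Z -> m a = init_mem n T d a) ->
  heap_ok n T d (exec n table_cmd m) /\ rd (exec n table_cmd m) rbest = 0%Z.
Proof.
move=> n0 cm hm.
rewrite /table_cmd -[exec _ _ _]/(exec n (CConst rbest 0)
  (exec n (CFor rq (cseq [:: CAdd rtmp rbase rq; CStore rtmp racc; CAdd racc racc rsize]))
  (exec n (CAdd racc rsize rone) (exec n (CFor rq (CAdd rbase rbase rsize))
  (exec n (CAdd rbase rsize rone) m))))).
set m1 := exec n (CAdd rbase rsize rone) m.
have [c1 c0 cn] := cm.
pose I i m := [/\ consts_ok n m, rd m rbase = Z.of_nat (n + 1 + i * n) &
  forall a, (0 <= a)%Z -> m a = init_mem n T d a].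
have I1 : I n (exec n (CFor rq (CAdd rbase rbase rsize)) m1).
  apply: exec_for.
    split; first by do 2!apply: wrt_consts => //.
      by rewrite /m1 /= !rd_wrt /= cn c1; lia.
    by move=> a ha; rewrite /m1 /= !wrt_heap ?hm.
  move=> i m2 lt [k1 k2 k3] ei; have [d1 d0 dn] := k1.
  rewrite /= !rd_wrt; split=> //; split; first by do 2!apply: wrt_consts => //.
    by rewrite !rd_wrt /= k2 dn mulSn; lia.
  by move=> a ha; rewrite !wrt_heap ?k3.
move: (exec n (CFor _ _) m1) I1 => m2 [{}cm k2 k3].
have {c1 c0 cn} [c1 c0 cn] := cm.
set m3 := exec n (CAdd racc rsize rone) m2.
pose J i m := [/\ consts_ok n m, rd m rbase = Z.of_nat (base n),
  rd m racc = Z.of_nat (n + 1 + i * n),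
  forall a, (0 <= a < Z.of_nat (base n))%Z -> m a = init_mem n T d a &
  forall u, u < i -> m (Z.of_nat (base n + u)) = Z.of_nat (n + 1 + u * n)].
set loop := CFor rq _.
have J1 : J n (exec n loop m3).
  apply: exec_for.
    split=> //; first by do 2!apply: wrt_consts => //.
    - by rewrite /m3 /= !rd_wrt.
    - by rewrite /m3 /= !rd_wrt /= cn c1; lia.
    - by move=> a ha; rewrite /m3 /= !wrt_heap ?k3; lia.
  move=> i m4 lt [l1 l2 l3 l4 l5] ei; have [d1 d0 dn] := l1.
  set m5 := exec n _ m4.
  have e5 : m5 = wrt (upd (wrt m4 rtmp (Z.of_nat (base n + i)))
      (Z.of_nat (base n + i)) (Z.of_nat (n + 1 + i * n))) racc
      (Z.of_nat (n + 1 + i.+1 * n)).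
    rewrite /m5 /= !rd_wrt /= l2 ei l3.
    have -> : (Z.of_nat (base n) + Z.of_nat i = Z.of_nat (base n + i))%Z by lia.
    case: Z.ltb_spec => h; first lia.
    rewrite !(rd_upd_heap _ _ _ h) !rd_wrt /= l3 dn.
    by congr (wrt _ _ _); rewrite mulSn; lia.
  clearbody m5.
  have h0 : (0 <= Z.of_nat (base n + i))%Z by exact: Nat2Z.is_nonneg.
  have rd5 r : r != racc -> r != rtmp -> rd m5 r = rd m4 r.
    by move=> r1 r2; rewrite e5 rd_wrt (negPf r1) rd_upd_heap // rd_wrt (negPf r2).
  have cm5 : consts_ok n m5 by split; rewrite rd5.
  split; [by rewrite rd5|by case: cm5|].
  split; rewrite ?rd_wrt /=.
  - exact: wrt_consts.
  - by rewrite rd5.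
  - by rewrite e5 rd_wrt eqxx.
  - move=> a ha; rewrite wrt_heap; last lia.
    rewrite e5 wrt_heap; last lia.
    rewrite /upd; case: Z.eqb_spec => [e|_]; first lia.
    by rewrite wrt_heap ?l4 //; lia.
  - move=> u; rewrite ltnS leq_eqVlt => hu.
    rewrite !wrt_heap; try exact: Nat2Z.is_nonneg.
    rewrite e5 wrt_heap; last exact: Nat2Z.is_nonneg.
    rewrite /upd; case: Z.eqb_spec => [e|ne]; first by have -> : u = i by lia.
    rewrite wrt_heap; last exact: Nat2Z.is_nonneg.
    by case/orP: hu => [/eqP e|/l5//]; rewrite e in ne.
move: (exec n loop m3) J1 => m4 [l1 l2 l3 l4 l5].
split; last by rewrite /= rd_wrt eqxx.
apply: (@heap_ok_exec _ _ _ (CConst _ _)) => //; split=> //.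
- move=> i lt; rewrite l4 ?init_mem_tour // /base; lia.
- move=> u v lu lv; rewrite l4 ?init_mem_dist //.
  have : u * n + v < n * n.
    by apply: (@leq_trans (u * n + n)); [rewrite ltn_add2l|rewrite addnC -mulSn leq_mul2r lu orbT].
  by rewrite /base; move: (u * n) (n * n) => a b; lia.
Qed.

(* Cell 0 receives the answer flag and cell 1+2t+s the endpoint s of edge t. *)
Definition output_reg (a : nat) : reg :=
  if a is a'.+1 then rout (a' %/ 2) (a' %% 2) else racc.

Definition output_cmd (s : seq nat) : cmd :=
  cseq [seq CSeq (CConst rtmp (Z.of_nat a)) (CStore rtmp (output_reg a)) | a <- s].

Lemma output_reg_tmp a : (output_reg a == rtmp) = false.
Proof. by case: a. Qed.

Lemma output_cmdE n s m a : uniq s ->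
  exec n (output_cmd s) m (Z.of_nat a) =
  if a \in s then rd m (output_reg a) else m (Z.of_nat a).
Proof.
elim: s m => // b s ih m /andP[bs us].
rewrite /output_cmd /= -/(output_cmd s) !rd_wrt eqxx output_reg_tmp.
case: Z.ltb_spec => h; first lia.
rewrite ih // rd_upd_heap // rd_wrt output_reg_tmp inE.
have [->|ne] := eqVneq a b.
  by rewrite (negPf bs) /upd Z.eqb_refl.
case: (a \in s) => //=; rewrite /upd; case: Z.eqb_spec => [e|_].
  by have := Nat2Z.inj _ _ e; move/eqP: ne.
by rewrite wrt_heap //; apply: Nat2Z.is_nonneg.
Qed.

Lemma output_cmd_shape s :
  [/\ wf (output_cmd s), depth (output_cmd s) <= 0 & writes_in nonconst (output_cmd s)].
Proof.
split.
- by rewrite wf_cseq all_map; apply/allP.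
- by apply: depth_cseq; rewrite all_map; apply/allP.
- by rewrite writes_in_cseq all_map; apply/allP.
Qed.

Local Opaque output_cmd.

(** Cells 0 to 4k: the flag, and two endpoints for each of the 2k edges. *)
Definition finish_cmd (k : nat) : cmd :=
  CSeq (CIf rbest rzero (CConst racc 1) (CConst racc 0)) (output_cmd (iota 0 (4 * k).+1)).

Lemma finish_cmdE n k m (m' := exec n (finish_cmd k) m) : rd m rzero = 0%Z ->
  [/\ m' 0%Z = (if (rd m rbest <? 0)%Z then 1 else 0)%Z,
      out_removed k m' = map (reg_edge m) (iota 0 k) &
      out_added k m' = map (reg_edge m) (iota k k)].
Proof.
move=> z; pose m1 := exec n (CIf rbest rzero (CConst racc 1) (CConst racc 0)) m.
have em' a : a <= 4 * k -> m' (Z.of_nat a) = rd m1 (output_reg a).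
  move=> ha; rewrite -[LHS]/(exec n (output_cmd (iota 0 (4 * k).+1)) m1 (Z.of_nat a)).
  by rewrite output_cmdE ?iota_uniq // mem_iota leq0n add0n ltnS ha.
have fr r : r != racc -> rd m1 r = rd m r.
  by move=> h; rewrite /m1 /=; case: ifP => _; rewrite rd_wrt (negPf h).
have eo t : t < 2 * k -> out_edge m' (1 + 2 * t) = reg_edge m t.
  move=> ht; rewrite /out_edge !em' /=; [|lia|lia].
  have e1 : (2 * t) %/ 2 = t by rewrite mulKn.
  have e2 : (2 * t).+1 %/ 2 = t by lia.
  have e3 : (2 * t) %% 2 = 0 by lia.
  have e4 : (2 * t).+1 %% 2 = 1 by lia.
  by rewrite !add0n e1 e2 e3 e4 !fr.
split.
- rewrite -[0%Z]/(Z.of_nat 0) em' // /m1 /= z.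
  by case: ifP => _; rewrite rd_wrt eqxx.
- apply/eq_in_map => t; rewrite mem_iota => /andP[_ lt]; apply: eo; lia.
- rewrite -[X in iota X _]addn0 iotaDl -map_comp.
  apply/eq_in_map => t; rewrite mem_iota => /andP[_ lt] /=.
  rewrite -eo; last lia.
  by congr (out_edge _ _); lia.
Qed.

Lemma main_program k : 2 < k ->
  exists c, [/\ wf c, writes_in nonconst c, depth c <= (2 * k) %/ 3 + 1 &
    forall n T d m, is_tour n T ->
      (forall i j, i < n -> j < n -> d i j = d j i) -> consts_ok n m ->
      (forall a, (0 <= a)%Z -> m a = init_mem n T d a) ->
      kopt_correct k n T d (exec n c m)].
Proof.
move=> k3; have k0 : 0 < k by lia.
have [|c [wfc wc nc dc sc]] := @words_program k (all_words k) k0.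
  by move=> w /all_wordsP.
have [bo1 bo2 bo3] := output_cmd_shape (iota 0 (4 * k).+1).
exists (cseq [:: table_cmd; c; finish_cmd k]); split.
- by rewrite wf_cseq /= wfc bo1.
- rewrite writes_in_cseq /= bo3 !andbT.
  by apply: writes_in_sub wc => r /andP[].
- apply: depth_cseq; rewrite /= dc andbT /= addn1 /= geq_max /=.
  by apply: leq_trans bo2 _.
move=> n T d m tourT symd cm hm.
rewrite -[exec _ _ _]/(exec n (finish_cmd k) (exec n c (exec n table_cmd m))).
have n0 : 0 < n by have := tour_gt2 tourT; lia.
have [hm1 b1] := table_cmdE n0 cm hm.
move: (exec n table_cmd m) hm1 b1 => m1 hm1 b1.
have g1 : good k n T d m1 by split=> //; rewrite /best_ok b1; split=> //; lia.
have [[hm2 [b2 X2]] _ opt] := sc n T d m1 tourT symd g1.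
move: (exec n c m1) hm2 b2 X2 opt => m2 hm2 b2 X2 opt.
have [[_ z2 _] _ _ _ _] := hm2.
have [e0 eX eY] := finish_cmdE n k z2.
(* Every k-move comes from some word and some positions, so the best value found bounds its gain. *)
have lower X Y : is_kmove k n T X Y -> (rd m2 rbest <= delta d X Y)%Z.
  move=> /(kmove_is_word tourT k0)[p [w [ip lp ww [pX pY]]]].
  rewrite (delta_perm d pX pY) delta_move_cost //; apply: opt => //.
  exact/all_wordsP.
rewrite /kopt_correct e0 eX eY; case: Z.ltb_spec => hb; last first.
  by left; split=> // X Y /lower; lia.
right; split=> //.
have [X [Y [mv dl e]]] := X2 hb.
have [[_ sX _] _ _] := mv.
have [-> ->] : map (reg_edge m2) (iota 0 k) = X /\ map (reg_edge m2) (iota k k) = Y.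
  move: e; rewrite iotaD map_cat add0n => /eqP; rewrite eqseq_cat ?size_map ?size_iota //.
  by move=> /andP[/eqP-> /eqP->].
split=> //; rewrite dl //.
Qed.

Theorem theorem8 (k : nat) (hk : 3 <= k) :
  exists (P : program) (C : nat),
    forall (n : nat) (T : seq nat) (d : nat -> nat -> Z),
      is_tour n T ->
      (forall i j, i < n -> j < n -> d i j = d j i) ->
      exists m : memory,
        run P (C * n ^ ((2 * k) %/ 3 + 1)) (0, init_mem n T d) = Some m /\
        kopt_correct k n T d m.
Proof.
have [c [wfc wc dc sc]] := main_program hk.
(* The constants that compiled code relies on; adding zero to cell 0 copies n, as there is no move
   instruction. *)
pose setup := [:: IConst (addr rone) 1; IConst (addr rzero) 0;
                  IAdd (addr rsize) 0 (addr rzero)].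
pose P := setup ++ code 3 c.
(* Three set-up instructions and the coefficient sum from [cost_bound]. *)
exists P, (3 + cost 1 c) => n T d tourT symd.
have n0 : 0 < n by have := tour_gt2 tourT; lia.
pose m0 := init_mem n T d.
pose m1 := wrt (wrt m0 rone 1) rzero 0.
pose m2 := wrt m1 rsize (m1 0 + rd m1 rzero)%Z.
have m10 : m1 0%Z = Z.of_nat n by rewrite /m1 !wrt_heap.
have z1 : rd m1 rzero = 0%Z by rewrite rd_wrt eqxx.
have cm : consts_ok n m2.
  split; [by rewrite /m2 /m1 !rd_wrt|by rewrite /m2 /m1 !rd_wrt|].
  by rewrite /m2 m10 z1 Z.add_0_r rd_wrt eqxx.
have hm2 a : (0 <= a)%Z -> m2 a = init_mem n T d a.
  by move=> ha; rewrite /m2 /m1 !wrt_heap.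
have s3 : steps P 3 (0, m0) (3, m2).
  exists (1, wrt m0 rone 1) => //; exists (2, m1) => //; exists (3, m2) => //.
have [|t le st] := @code_steps n P c 3 m2 n0 wfc wc cm.
  by exists setup, [::]; rewrite cats0.
exists (exec n c m2); split; last exact: sc.
apply: (run_steps (steps_trans s3 st)).
  rewrite mulnDl; apply: leq_add; first by rewrite leq_pmulr // expn_gt0 n0.
  apply: (leq_trans le); apply: (leq_trans (cost_bound c n0)).
  by rewrite leq_mul2l leq_pexp2l ?orbT.
by rewrite size_cat size_code.
Qed.
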